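(* Let $n\ge 2$, let $K\subset\mathbb{R}^n$ be a convex body of constant width $\Theta$, and let $\gamma\subset\mathbb{R}^n$ be any curve such that $K\subset\operatorname{co}(\gamma)$. Then $$ \operatorname{length}(\gamma)\ge \frac{2(\pi-1)\,\Gamma\!\left(\frac{n+1}{2}\right)}{\sqrt{\pi}\,\Gamma\!\left(\frac{n}{2}\right)}\cdot\Theta, $$ where $\Gamma$ is the gamma function.
   Context: $\mathbb{R}^n$ carries the standard Euclidean metric $d$. A convex body is any nonempty compact convex subset of $\mathbb{R}^n$. $\operatorname{co}(A)$ denotes the convex hull of $A$. The support function of $K$ is $h(K,u)=\sup\{(x,u):x\in K\}$ and the width function is $w(K,u)=h(K,u)+h(K,-u)$ for $u$ in the unit sphere $S^{n-1}$; $K$ has constant width $\Theta$ if $w(K,u)=\Theta$ for all $u\in S^{n-1}$. A curve is the image of a continuous map $\varphi:[a,b]\to\mathbb{R}^n$; its length is $\operatorname{length}(\gamma)=\sup\sum_{i=1}^m d(\varphi(t_{i-1}),\varphi(t_i))$ over all partitions $a=t_0<\dots<t_m=b$ (possibly $+\infty$). *)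

(* Defs.v *)
From HB Require Import structures.
From mathcomp Require Import all_boot all_order all_algebra.
From mathcomp Require Import all_classical all_reals all_analysis.
Set Implicit Arguments. Unset Strict Implicit. Unset Printing Implicit Defensive.
Import Order.TTheory GRing.Theory Num.Theory.
Import numFieldNormedType.Exports.
Local Open Scope classical_set_scope.
Local Open Scope ring_scope.

Section Defs.
Variable R : realType.

Definition dotp n (x y : 'rV[R]_n) : R := \sum_(i < n) x ord0 i * y ord0 i.

Definition edist n (x y : 'rV[R]_n) : R := Num.sqrt (dotp (x - y) (x - y)).

Definition convex_set n (K : set 'rV[R]_n) : Prop :=
  forall x y t, K x -> K y -> 0 <= t <= 1 -> K (t *: x + (1 - t) *: y).

Definition convex_body n (K : set 'rV[R]_n) : Prop :=
  K !=set0 /\ compact K /\ convex_set K.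

Definition co n (A : set 'rV[R]_n) : set 'rV[R]_n :=
  [set x | exists (m : nat) (p : 'I_m -> 'rV[R]_n) (l : 'I_m -> R),
     (forall i, A (p i)) /\ (forall i, 0 <= l i) /\
     \sum_(i < m) l i = 1 /\ x = \sum_(i < m) l i *: p i].

Definition support_fun n (K : set 'rV[R]_n) (u : 'rV[R]_n) : R :=
  sup [set dotp x u | x in K].

Definition width_fun n (K : set 'rV[R]_n) (u : 'rV[R]_n) : R :=
  support_fun K u + support_fun K (- u).

Definition constant_width n (K : set 'rV[R]_n) (Theta : R) : Prop :=
  forall u : 'rV[R]_n, dotp u u = 1 -> width_fun K u = Theta.

Definition partition (a b : R) (m : nat) (t : nat -> R) : Prop :=
  t 0%N = a /\ t m = b /\ (forall i, (i < m)%N -> t i < t i.+1).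

Definition curve_length n (phi : R -> 'rV[R]_n) (a b : R) : \bar R :=
  ereal_sup [set l : \bar R | exists (m : nat) (t : nat -> R),
     partition a b m t /\
     l = (\sum_(i < m) edist (phi (t i)) (phi (t i.+1)))%:E].

Definition Gamma (x : R) : R :=
  Rintegral lebesgue_measure `]0, +oo[%classic
    (fun t : R => t `^ (x - 1) * expR (- t)).

End Defs.

(* Main.v *)
Require Import Defs.
From HB Require Import structures.
From mathcomp Require Import all_boot all_order all_algebra.
From mathcomp Require Import all_classical all_reals all_analysis.
From mathcomp Require Import measurable_realfun ring lra.
Set Implicit Arguments. Unset Strict Implicit. Unset Printing Implicit Defensive.
Import Order.TTheory GRing.Theory Num.Theory.
Import numFieldNormedType.Exports.
Local Open Scope classical_set_scope.
Local Open Scope ring_scope.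

(** Inscribe in the curve a polygon [P_0 ... P_m] coming within [e] of every
    point of the curve.  In a unit direction [u] it must sweep an interval of
    length at least [Theta - 2e], so the total variation of [(P_i, u)] is at
    least [2 (Theta - 2e) - |(P_0 - P_m, u)|].  Averaging over all directions,
    with a Gaussian vector [g] in place of [u], turns total variation into
    length (since [E |(v, g)| = |v| / sqrt pi]) and gives
    [length >= 2 sqrt pi rho_n Theta - d], where [rho_n = E |g| =
    Gamma ((n + 1) / 2) / Gamma (n / 2)] and [d = |P_0 - P_m|].
    If [d <= 2 rho_n Theta / sqrt pi], this is the claim.  Otherwise project
    along [P_0 - P_m]: the projected polygon is closed, so the same estimate in
    dimension [n - 1] bounds its length below by [2 sqrt pi rho_(n-1) Theta],
    while the component along [P_0 - P_m] has variation at least [d].  Hence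
    [length ^ 2 >= d ^ 2 + 4 pi rho_(n-1) ^ 2 Theta ^ 2], and
    [rho_(n-1) ^ 2 >= (1 - 2 / pi) rho_n ^ 2] makes this large enough. *)

(** * A rational upper bound for pi *)

(** Makes [1 - 2 / pi] at most [3 / 8] in [rho_ratio]. It holds because [cos] is nonnegative up to
    [pi / 2] but negative at [8 / 5]. *)
Lemma pi_lt_16_5 (R : realType) : pi < 16 / 5 :> R.
Proof.
suff cos_lt0 : cos (8 / 5) < 0 :> R.
  rewrite ltNge; apply/negP => pi_ge.
  have : 0 <= cos (8 / 5) :> R.
    by apply: cos_ge0_pihalf; have := pi_ge2 R; lra.
  by rewrite leNgt cos_lt0.
rewrite -(opprK (cos _)) oppr_lt0; have /cvgN h := @cvg_cos_coeff' R (8 / 5).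
rewrite -(cvg_lim (@Rhausdorff R) h).
(* [cos x < 1 - x ^ 2 / 2 + x ^ 4 / 24] is already negative at [x = 8 / 5] *)
apply: (@lt_trans _ _ (\sum_(0 <= i < 3) - cos_coeff' (8 / 5) i)).
  do 3 rewrite big_nat_recl//; rewrite big_nil addr0 /cos_coeff' /=.
  rewrite ?expr0z ?expr1z.
  have -> : ((-1 : R) ^ 2%N) = 1 by rewrite -exprnP; lra.
  have -> : 0`! = 1%N by [].
  have -> : (1.*2)`! = 2%N by [].
  have -> : (2.*2)`! = 24%N by [].
  rewrite -[1.*2]/2%N -[2.*2]/4%N; lra.
rewrite -seriesN lt_sum_lim_series //.
  by move/cvgP in h; by rewrite seriesN.
(* The remaining terms are grouped in pairs. Each pair is positive, since the second term is smaller
   than the first by the factor [(8 / 5) ^ 2] over a product of at least [7 * 8]. *)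
move=> d.
have sgn (k : nat) : (-1 : R) ^ k = (-1) ^+ (odd k) by rewrite -exprnP signr_odd.
rewrite /cos_coeff' !sgn !oddD odd_double /= ?expr0 ?expr1.
rewrite odd_double /= expr0 addnS doubleS.
have : (6 <= (3 + d.*2).*2)%N by rewrite -[6%N]/(3.*2) leq_double leq_addr.
move: (3 + d.*2)%N.*2 => k k6.
rewrite (factS k.+1) (factS k) !natrM (exprS _ k.+1) (exprS _ k) !invfM.
set N := k`!; set X := (8 / 5) ^+ _.
have X0 : 0 < X by apply: exprn_gt0; lra.
have N0 : 0 < X / N%:R by rewrite divr_gt0 // ltr0n fact_gt0.
set p := k.+2%:R; set q := k.+1%:R.
have p8 : p^-1 <= 8^-1 :> R by rewrite lef_pV2 ?posrE ?ltr0n// ler_nat.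
have q7 : q^-1 <= 7^-1 :> R by rewrite lef_pV2 ?posrE ?ltr0n// ler_nat.
have p0 : 0 < p^-1 :> R by rewrite invr_gt0 ltr0n.
have q0 : 0 < q^-1 :> R by rewrite invr_gt0 ltr0n.
have -> : - (-1 * X / N%:R) - 1 * (8 / 5 * (8 / 5 * X)) * (p^-1 * (q^-1 / N%:R))
  = (1 - 8 / 5 * (8 / 5) * (p^-1 * q^-1)) * (X / N%:R) by ring.
apply: mulr_gt0 => //; rewrite subr_gt0.
have : p^-1 * q^-1 <= 8^-1 * 7^-1 by apply: ler_pM => //; exact: ltW.
by move: (p^-1 / q) => z; lra.
Qed.

(** * Gaussian means on the line *)

Section GaussMean.
Variable R : realType.
Notation mu := (@lebesgue_measure R).

(** Stated for nonnegative integrands in the extended reals, so that it applies before an integral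
    is known to be finite; it serves both the stability of the Gaussian law and the polar
    substitution. *)
Lemma ge0_integral_affine (G : R -> R) (c d : R) : 0 < c ->
  continuous G -> (forall x, 0 <= G x) ->
  (\int[mu]_x (G x)%:E = \int[mu]_x (G (c * x + d) * c)%:E)%E.
Proof.
move=> c0 cG G0; pose F (x : R^o) : R^o := (x + d / c) * c.
have FE x : F x = c * x + d by rewrite /F mulrDl divfK ?gt_eqF// mulrC.
have F'E : F^`()%classic = cst c.
  apply/funext => x; rewrite /F derive1E deriveM// deriveD// derive_cst scaler0.
  by rewrite add0r derive_id derive_cst addr0 [LHS]mulr1.
rewrite (@increasing_ge0_integration_by_substitutionT _ F G)//.
- by rewrite F'E; apply: eq_integral => x _; rewrite !fctE/= -FE.
- by move=> x y xy; rewrite !FE ltrD2r ltr_pM2l.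
- by rewrite F'E => ?; exact: cvg_cst.
- by rewrite F'E; exact: is_cvg_cst.
- by rewrite F'E; exact: is_cvg_cst.
- by apply/gt0_cvgMlNy => //; exact: cvg_addrr_Ny.
- by apply/gt0_cvgMly => //; exact: cvg_addrr.
Qed.

Lemma continuous_affine (c d : R) : continuous (fun x : R => c * x + d).
Proof.
move=> x; apply: cvgD; last exact: cvg_cst.
by apply: cvgMr; exact: cvg_id.
Qed.

(** One regularity class for all integrands: it gives measurability and linear growth, hence
    Gaussian integrability, and partial means stay in it. *)
Definition lip (f : R -> R) := exists L, forall x y, `|f x - f y| <= L * `|x - y|.

Lemma lip_continuous f : lip f -> continuous f.
Proof.
move=> [L fL] x; apply/cvgrPdist_le => /= e e0.
near=> y; apply: (le_trans (fL x y)).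
have L1 : 0 < `|L| + 1 by rewrite ltr_wpDl.
apply: (@le_trans _ _ ((`|L| + 1) * `|x - y|)).
  by rewrite ler_wpM2r// (le_trans (ler_norm _))// lerDl.
rewrite mulrC -ler_pdivlMr//.
near: y; apply: cvgr_dist_le; [exact: cvg_id|exact: divr_gt0].
Unshelve. all: by end_near. Qed.

Lemma is_derive_gauss_fun (x : R) :
  is_derive x (1 : R) (fun x => - gauss_fun x / 2) (x * gauss_fun x).
Proof.
rewrite /gauss_fun.
have h1 : is_derive x (1 : R) (fun x : R => - x ^+ 2) (- (2 * x)).
  apply: is_derive_eq; rewrite /GRing.scale /=; ring.
have h2 : is_derive x (1 : R) (fun x : R => expR (- x ^+ 2)) (expR (- x ^+ 2) * - (2 * x)).
  exact: (is_derive1_comp (is_derive_expR _) h1).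
by apply: is_derive_eq; rewrite /GRing.scale /=; field.
Qed.

(** By symmetry this is twice the integral over the half-line, where [x * gauss_fun x] has the
    antiderivative [- gauss_fun x / 2]. *)
Lemma integral_normr_gauss :
  (\int[mu]_x (`|x| * gauss_fun x)%:E = 1)%E.
Proof.
rewrite ge0_symfun_integralT//=; last 3 first.
- by move=> x; rewrite mulr_ge0// gauss_fun_ge0.
- move=> x; apply: cvgM; first exact: norm_continuous.
  exact: continuous_gauss_fun.
- by move=> x /=; rewrite normrN /gauss_fun sqrrN.
rewrite (_ : [set x | _] = `[0, +oo[%classic); last first.
  by apply/seteqP; split => x/=; rewrite in_itv/= andbT.
transitivity (2%:E * \int[mu]_(x in `[0%R, +oo[) (x * gauss_fun x)%:E)%E.
  congr (_ * _)%E; apply: eq_integral => x; rewrite inE/= in_itv/= andbT => x0.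
  by rewrite ger0_norm.
rewrite (@ge0_continuous_FTC2y _ (fun x => x * gauss_fun x) (fun x => - gauss_fun x / 2) 0 0).
- by rewrite /gauss_fun expr0n oppr0 expR0 sub0e -EFinN -EFinM; congr EFin; lra.
- by move=> x x0; rewrite mulr_ge0// gauss_fun_ge0.
- apply: continuous_subspaceT => x; apply: cvgM; first exact: cvg_id.
  exact: continuous_gauss_fun.
- have -> : 0 = - 0 / 2 :> R by rewrite oppr0 mul0r.
  by apply: cvgMl; apply: cvgN; exact: cvg_gauss_fun.
- by move=> x _; case: (is_derive_gauss_fun x).
- apply: cvg_at_right_filter; apply: cvgMl; apply: cvgN.
  exact: continuous_gauss_fun.
- by move=> x _; rewrite derive1E; case: (is_derive_gauss_fun x).
Qed.

Lemma integrable_normr_gauss :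
  mu.-integrable setT (EFin \o (fun x : R => `|x| * gauss_fun x)).
Proof.
apply/integrableP; split.
  apply/measurable_EFinP/measurable_funM; last exact: measurable_gauss_fun.
  by apply: continuous_measurable_fun; exact: norm_continuous.
under eq_integral do rewrite /= ger0_norm ?mulr_ge0 ?gauss_fun_ge0//.
by rewrite integral_normr_gauss ltry.
Qed.

(** Dominated by [|f 0| + |L| |x|] times the Gaussian weight. *)
Lemma lip_integrable (f : R -> R) : lip f ->
  mu.-integrable setT (EFin \o (fun x => f x * gauss_fun x)).
Proof.
move=> /[dup] /lip_continuous cf [L fL].
have mf : measurable_fun setT f by exact: continuous_measurable_fun.
have : mu.-integrable setT (fun x : R => `|f 0|%:E * (gauss_fun x)%:E
    + `|L|%:E * (`|x| * gauss_fun x)%:E)%E.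
  apply: integrableD => //; apply: integrableZl => //.
    exact: integrableT_gauss.
  exact: integrable_normr_gauss.
apply: le_integrable => //.
  by apply/measurable_EFinP/measurable_funM => //; exact: measurable_gauss_fun.
move=> x _ /=; rewrite lee_fin normrM (ger0_norm (gauss_fun_ge0 x)).
rewrite [leRHS]ger0_norm; last first.
  by rewrite addr_ge0// !mulr_ge0// gauss_fun_ge0.
rewrite mulrA -mulrDl ler_wpM2r ?gauss_fun_ge0//.
have := fL x 0; rewrite subr0 => fx.
have -> : f x = f 0 + (f x - f 0) by ring.
apply: (le_trans (ler_normD _ _)); rewrite lerD2l (le_trans fx)//.
by rewrite ler_wpM2r// ler_norm.
Qed.

(* The mean of [f] for the density [exp (- x ^ 2) / sqrt pi], so that no factor
   [sqrt 2] appears in the Gamma quotients below. *)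
Definition gmean (f : R -> R) : R :=
  (Num.sqrt pi)^-1 * (\int[mu]_x (f x * gauss_fun x)).

Lemma gmeanE f : lip f ->
  ((gmean f)%:E = (Num.sqrt pi)^-1%:E * \int[mu]_x (f x * gauss_fun x)%:E)%E.
Proof.
move=> lf; rewrite /gmean EFinM fineK//.
by apply: integrable_fin_num => //; exact: lip_integrable.
Qed.

Lemma sqrt_pi_gt0 : 0 < Num.sqrt pi :> R.
Proof. by rewrite sqrtr_gt0 pi_gt0. Qed.

Lemma lip_cst c : lip (fun=> c).
Proof. by exists 0 => x y; rewrite subrr normr0 mul0r. Qed.

Lemma gmean_cst c : gmean (fun=> c) = c.
Proof.
rewrite /gmean RintegralZl//; last exact: integrableT_gauss.
by rewrite /Rintegral integralT_gauss /= mulrCA mulVf ?mulr1// gt_eqF ?sqrt_pi_gt0.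
Qed.

Lemma lipD f g : lip f -> lip g -> lip (fun x => f x + g x).
Proof.
move=> [L fL] [M gM]; exists (L + M) => x y.
have -> : f x + g x - (f y + g y) = (f x - f y) + (g x - g y) by ring.
by rewrite mulrDl (le_trans (ler_normD _ _))// lerD.
Qed.

Lemma gmeanD f g : lip f -> lip g ->
  gmean (fun x => f x + g x) = gmean f + gmean g.
Proof.
move=> lf lg; rewrite /gmean -mulrDr -RintegralD//; try exact: lip_integrable.
by congr (_ * _); apply: eq_Rintegral => x _; rewrite mulrDl.
Qed.

Lemma gmeanZ c f : lip f -> gmean (fun x => c * f x) = c * gmean f.
Proof.
move=> lf; rewrite /gmean [RHS]mulrCA; congr (_ * _).
rewrite -RintegralZl//; first by apply: eq_Rintegral => x _; rewrite mulrA.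
exact: lip_integrable.
Qed.

Lemma gmean_le f g : lip f -> lip g -> (forall x, f x <= g x) ->
  gmean f <= gmean g.
Proof.
move=> lf lg fg; rewrite /gmean ler_wpM2l ?invr_ge0 ?sqrtr_ge0//.
apply: le_Rintegral => //; try exact: lip_integrable.
by move=> x _; rewrite ler_wpM2r ?gauss_fun_ge0.
Qed.

Lemma eq_gmean f g : f =1 g -> gmean f = gmean g.
Proof. by move=> /funext->. Qed.

(** Means contract the uniform distance, which makes a partial mean Lipschitz in its parameter
    ([lip_gmean]). *)
Lemma gmean_dist f g e : lip f -> lip g -> (forall x, `|f x - g x| <= e) ->
  `|gmean f - gmean g| <= e.
Proof.
have H h k : lip h -> lip k -> (forall x, `|h x - k x| <= e) ->
    gmean h - gmean k <= e.
  move=> lh lk hk; rewrite lerBlDl -[X in _ + X](gmean_cst e) -gmeanD//; last exact: lip_cst.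
  apply: gmean_le => //; first by apply: lipD => //; exact: lip_cst.
  by move=> x; rewrite -lerBlDl (le_trans (ler_norm _)).
move=> lf lg fg; rewrite ler_norml; apply/andP; split; last exact: H.
by rewrite lerNl opprB; apply: H => // x; rewrite distrC.
Qed.

Lemma gmean_normr : gmean (fun x => `|x|) = (Num.sqrt pi)^-1.
Proof. by rewrite /gmean /Rintegral integral_normr_gauss mulr1. Qed.

End GaussMean.

(** * Stability of the Gaussian law *)

Section Stable.
Variable R : realType.
Notation mu := (@lebesgue_measure R).
Notation g := (@gauss_fun R).

Lemma ge0_lebesgue_fubini (H : R * R -> \bar R) : measurable_fun setT H ->
  (forall p, (0 <= H p)%E) ->
  (\int[mu]_x \int[mu]_y H (x, y) = \int[mu]_y \int[mu]_x H (x, y))%E.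
Proof.
exact: (@fubini_tonelli _ _ _ _ R (mu : {sigma_finite_measure set _ -> \bar R})
  (mu : {sigma_finite_measure set _ -> \bar R})).
Qed.

(** Symmetry of the Gaussian weight, for a negative [a] in [gmean_stable] when [b = 0]. *)
Lemma gmeanN (f : R -> R) : lip f -> (forall x, 0 <= f x) ->
  gmean (fun x => f (- x)) = gmean f.
Proof.
move=> lf f0; rewrite /gmean /Rintegral; congr (_ * fine _).
pose h x := (f x * g x)%:E.
transitivity (\int[pushforward mu (-%R : _ -> measurableTypeR R)]_x h x)%E.
  rewrite ge0_integral_pushforward//=.
  - by apply: eq_integral => x _; rewrite /h/= /gauss_fun sqrrN.
  - apply/measurable_EFinP/measurable_funM; last exact: measurable_gauss_fun.
    by apply: continuous_measurable_fun; exact: lip_continuous.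
  - by move=> x _; rewrite lee_fin mulr_ge0 ?gauss_fun_ge0.
by apply: eq_measure_integral => //= A mA _; exact: lebesgue_measureN.
Qed.

Lemma lip_affine (F : R -> R) (c d : R) : lip F -> lip (fun x => F (c * x + d)).
Proof.
move=> [L FL]; exists (L * `|c|) => x y; apply: (le_trans (FL _ _)).
by rewrite opprD addrACA subrr addr0 -mulrBr normrM mulrA.
Qed.

Lemma lip_gmean (f : R -> R -> R) L : (forall s, lip (f s)) ->
  (forall s s' t, `|f s t - f s' t| <= L * `|s - s'|) ->
  lip (fun s => gmean (f s)).
Proof. by move=> lf fL; exists L => s s'; apply: gmean_dist. Qed.

(* With [r = sqrt (a ^ 2 + b ^ 2)], substitute [b t + a s = r z] and complete the
   square: [s ^ 2 + t ^ 2 = z ^ 2 + ((r s - a z) / b) ^ 2]. *)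
Lemma gmean_stable_pos (F : R -> R) (a b : R) : 0 < b -> lip F -> (forall x, 0 <= F x) ->
  gmean (fun s => gmean (fun t => F (b * t + a * s))) =
  gmean (fun z => F (Num.sqrt (a ^+ 2 + b ^+ 2) * z)).
Proof.
move=> b0 lF F0; set r := Num.sqrt _.
have r0 : 0 < r by rewrite sqrtr_gt0 ltr_wpDl ?sqr_ge0// exprn_gt0.
have r2 : r ^+ 2 = a ^+ 2 + b ^+ 2 by rewrite sqr_sqrtr// addr_ge0 ?sqr_ge0.
have cF := lip_continuous lF.
have mF : measurable_fun setT F by exact: continuous_measurable_fun.
have cg := @continuous_gauss_fun R.
have lr : lip (fun z => F (r * z)).
  by have := lip_affine r 0 lF; congr lip; apply/funext => z; rewrite addr0.
have l2 : lip (fun s => gmean (fun t => F (b * t + a * s))).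
  have [L FL] := lF.
  apply: (@lip_gmean _ (L * `|a|)) => [s|s s' t]; first exact: lip_affine.
  apply: (le_trans (FL _ _)).
  have -> : b * t + a * s - (b * t + a * s') = a * (s - s') by ring.
  by rewrite normrM mulrA.
apply/eqP; rewrite -eqe; apply/eqP; rewrite gmeanE// [RHS]gmeanE//.
set c := (Num.sqrt pi)^-1.
have c0 : 0 <= c by rewrite invr_ge0 sqrtr_ge0.
(* Here [p = (s, z)]: the joint integrand after the substitution, Jacobian [r / b] included,
   factored so that [s] occurs in a single Gaussian factor. *)
pose H (p : R * R) := (F (r * p.2) * g p.2 * (g (r / b * p.1 + - (a / b) * p.2) * (r / b)))%:E.
have H0 p : (0 <= H p)%E.
  by rewrite lee_fin !mulr_ge0 ?gauss_fun_ge0 ?invr_ge0 // ltW.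
have mH : measurable_fun setT H.
  have mlin (u v : R) : measurable_fun setT (fun p : R * R => u * p.1 + v * p.2).
    by apply: measurable_funD; apply: measurable_funM.
  apply/measurable_EFinP; apply: measurable_funM.
    apply: measurable_funM.
      by apply: measurableT_comp => //; apply: measurable_funM.
    by apply: measurableT_comp => //; exact: measurable_gauss_fun.
  apply: measurable_funM => //.
  by apply: measurableT_comp => //; exact: measurable_gauss_fun.
have inner s : ((gmean (fun t => F (b * t + a * s)) * g s)%:E =
    c%:E * \int[mu]_z H (s, z))%E.
  rewrite EFinM gmeanE; last exact: lip_affine.
  rewrite -muleA; congr (_ * _)%E.
  rewrite -ge0_integralZr//; last 3 first.
  - apply/measurable_EFinP/measurable_funM; last exact: measurable_gauss_fun.
    by apply: continuous_measurable_fun; apply: lip_continuous; exact: lip_affine.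
  - by move=> t _; rewrite lee_fin mulr_ge0 ?gauss_fun_ge0.
  - by rewrite lee_fin gauss_fun_ge0.
  rewrite (@ge0_integral_affine _ (fun t => F (b * t + a * s) * g t * g s) (r / b) (- (a * s / b))).
  - apply: eq_integral => z _; rewrite /H /=; congr EFin.
    have -> : b * (r / b * z - a * s / b) + a * s = r * z.
      by field; rewrite gt_eqF.
    rewrite -!mulrA; congr (_ * _); rewrite !mulrA; congr (_ / _ ); congr (_ * _).
    rewrite /gauss_fun -!expRD; congr expR.
    have -> : - (r / b * z - a * s / b) ^+ 2 - s ^+ 2 =
       - ((r ^+ 2) * z ^+ 2 - 2 * a * r * s * z + (a ^+ 2 + b ^+ 2) * s ^+ 2) / b ^+ 2.
      by field; rewrite gt_eqF.
    by rewrite -r2 r2; field: r2; rewrite gt_eqF.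
  - exact: divr_gt0.
  - move=> t; apply: cvgM; last exact: cvg_cst.
    apply: cvgM; last exact: cg.
    by apply: lip_continuous; exact: lip_affine.
  - by move=> t; rewrite !mulr_ge0 ?gauss_fun_ge0.
under eq_integral do rewrite inner.
rewrite ge0_integralZl//; last 2 first.
- exact: measurable_fun_fubini_tonelli_F.
- by move=> s _; exact: integral_ge0.
(* For fixed [z] the integral over [s] is that of an affinely rescaled Gaussian, namely [sqrt pi];
   it cancels one of the two normalizing factors. *)
rewrite (ge0_lebesgue_fubini mH H0) muleA.
transitivity (c%:E * c%:E * \int[mu]_z ((F (r * z) * g z)%:E * (Num.sqrt pi)%:E))%E.
  congr (_ * _)%E; apply: eq_integral => z _; rewrite /H /=.
  under eq_integral do rewrite EFinM.
  rewrite ge0_integralZl//; last 3 first.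
  - apply/measurable_EFinP/measurable_funM => //.
    apply: continuous_measurable_fun => x.
    by apply: continuous_comp; [exact: continuous_affine|exact: cg].
  - by move=> s _; rewrite lee_fin !mulr_ge0 ?gauss_fun_ge0 ?invr_ge0 // ltW.
  - by rewrite lee_fin !mulr_ge0 ?gauss_fun_ge0.
  congr (_ * _)%E; rewrite -ge0_integral_affine//.
  - exact: integralT_gauss.
  - exact: divr_gt0.
  - by move=> x; exact: gauss_fun_ge0.
rewrite ge0_integralZr//; last 2 first.
- apply/measurable_EFinP/measurable_funM; last exact: measurable_gauss_fun.
  by apply: continuous_measurable_fun; exact: lip_continuous.
- by move=> z _; rewrite lee_fin mulr_ge0 ?gauss_fun_ge0.
rewrite [(_ * (Num.sqrt pi)%:E)%E]muleC -!muleA; congr (_ * _)%E.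
by rewrite muleA -EFinM mulVf ?mul1e// gt_eqF ?sqrt_pi_gt0.
Qed.

(** The case [b = 0] is included because [b] will be the norm of the tail of a vector. *)
Lemma gmean_stable (F : R -> R) (a b : R) : 0 <= b -> lip F -> (forall x, 0 <= F x) ->
  gmean (fun s => gmean (fun t => F (b * t + a * s))) =
  gmean (fun z => F (Num.sqrt (a ^+ 2 + b ^+ 2) * z)).
Proof.
rewrite le_eqVlt => /predU1P[<- lF F0|]; last exact: gmean_stable_pos.
rewrite expr0n addr0 sqrtr_sqr.
under eq_gmean => s do under eq_gmean => t do rewrite mul0r add0r.
under eq_gmean => s do rewrite gmean_cst.
have [a0|a0] := lerP 0 a; first by rewrite ger0_norm.
rewrite ltr0_norm//.
rewrite -[LHS]gmeanN//.
  by apply: eq_gmean => x; rewrite mulrN mulNr.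
by have := lip_affine a 0 lF; congr lip; apply/funext => z; rewrite addr0.
Qed.
End Stable.

(** * Gaussian means on row vectors *)

Section Vec.
Variable R : realType.

Definition enorm n (x : 'rV[R]_n) : R := Num.sqrt (dotp x x).

Definition vcons n (s : R) (x : 'rV[R]_n) : 'rV[R]_n.+1 :=
  \row_i oapp (x ord0) s (unlift ord0 i).

Definition vtail n (x : 'rV[R]_n.+1) : 'rV[R]_n := \row_j x ord0 (lift ord0 j).

Lemma vcons0 n s (x : 'rV[R]_n) : vcons s x ord0 ord0 = s.
Proof. by rewrite mxE unlift_none. Qed.

Lemma vconsS n s (x : 'rV[R]_n) j : vcons s x ord0 (lift ord0 j) = x ord0 j.
Proof. by rewrite mxE liftK. Qed.

Lemma dotpC n (x y : 'rV[R]_n) : dotp x y = dotp y x.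
Proof. by apply: eq_bigr => i _; rewrite mulrC. Qed.

Lemma dotpDl n (x y z : 'rV[R]_n) : dotp (x + y) z = dotp x z + dotp y z.
Proof. by rewrite -big_split; apply: eq_bigr => i _; rewrite mxE mulrDl. Qed.

Lemma dotpZl n c (x z : 'rV[R]_n) : dotp (c *: x) z = c * dotp x z.
Proof. by rewrite /dotp mulr_sumr; apply: eq_bigr => i _; rewrite mxE mulrA. Qed.

Lemma dotpNl n (x z : 'rV[R]_n) : dotp (- x) z = - dotp x z.
Proof. by rewrite -scaleN1r dotpZl mulN1r. Qed.

Lemma dotpBl n (x y z : 'rV[R]_n) : dotp (x - y) z = dotp x z - dotp y z.
Proof. by rewrite dotpDl dotpNl. Qed.

Lemma dotpDr n (x y z : 'rV[R]_n) : dotp z (x + y) = dotp z x + dotp z y.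
Proof. by rewrite !(dotpC z) dotpDl. Qed.

Lemma dotpZr n c (x z : 'rV[R]_n) : dotp z (c *: x) = c * dotp z x.
Proof. by rewrite !(dotpC z) dotpZl. Qed.

Lemma dotpNr n (x z : 'rV[R]_n) : dotp z (- x) = - dotp z x.
Proof. by rewrite !(dotpC z) dotpNl. Qed.

Lemma dotpBr n (x y z : 'rV[R]_n) : dotp z (x - y) = dotp z x - dotp z y.
Proof. by rewrite !(dotpC z) dotpBl. Qed.

Lemma dotp_ge0 n (x : 'rV[R]_n) : 0 <= dotp x x.
Proof. by apply: sumr_ge0 => i _; rewrite -expr2 sqr_ge0. Qed.

Lemma enorm_ge0 n (x : 'rV[R]_n) : 0 <= enorm x.
Proof. exact: sqrtr_ge0. Qed.

Lemma sqr_enorm n (x : 'rV[R]_n) : enorm x ^+ 2 = dotp x x.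
Proof. by rewrite sqr_sqrtr// dotp_ge0. Qed.

Lemma enorm_eq0 n (x : 'rV[R]_n) : enorm x = 0 -> x = 0.
Proof.
move=> x0; have := sqr_enorm x; rewrite x0 expr0n => /esym/eqP.
rewrite psumr_eq0 => [/allP h|i _]; last by rewrite -expr2 sqr_ge0.
apply/rowP => i; rewrite mxE; apply/eqP.
by have := h i (mem_index_enum _); rewrite mulf_eq0 orbb.
Qed.

Lemma enormZ n c (x : 'rV[R]_n) : enorm (c *: x) = `|c| * enorm x.
Proof.
by rewrite /enorm dotpZl dotpZr mulrA -expr2 sqrtrM ?sqr_ge0// sqrtr_sqr.
Qed.

Lemma dotp_vcons n (x : 'rV[R]_n.+1) s (y : 'rV[R]_n) :
  dotp x (vcons s y) = x ord0 ord0 * s + dotp (vtail x) y.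
Proof.
rewrite /dotp big_ord_recl vcons0; congr (_ + _).
by apply: eq_bigr => i _; rewrite vconsS mxE.
Qed.

Lemma vtail_vcons n s (y : 'rV[R]_n) : vtail (vcons s y) = y.
Proof. by apply/rowP => j; rewrite mxE vconsS. Qed.

Lemma dotp_vcons2 n s (y : 'rV[R]_n) :
  dotp (vcons s y) (vcons s y) = s ^+ 2 + dotp y y.
Proof. by rewrite dotp_vcons vcons0 vtail_vcons expr2. Qed.

Lemma dotp_vtail n (x : 'rV[R]_n.+1) :
  dotp x x = x ord0 ord0 ^+ 2 + dotp (vtail x) (vtail x).
Proof.
rewrite /dotp big_ord_recl expr2; congr (_ + _).
by apply: eq_bigr => i _; rewrite mxE.
Qed.

Lemma enorm_vcons n s (y : 'rV[R]_n) :
  enorm (vcons s y) = Num.sqrt (s ^+ 2 + enorm y ^+ 2).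
Proof. by rewrite sqr_enorm -dotp_vcons2. Qed.

Definition norm1 n (x : 'rV[R]_n) : R := \sum_i `|x ord0 i|.

Lemma norm1_vcons n s s' (x y : 'rV[R]_n) :
  norm1 (vcons s x - vcons s' y) = `|s - s'| + norm1 (x - y).
Proof.
rewrite /norm1 big_ord_recl !mxE unlift_none; congr (_ + _).
by apply: eq_bigr => i _; rewrite !mxE !liftK.
Qed.

Lemma norm1_0 n : norm1 (0 : 'rV[R]_n) = 0.
Proof. by rewrite /norm1 big1// => i _; rewrite mxE normr0. Qed.

(** The sum norm splits off one coordinate additively ([norm1_vcons]), so freezing a coordinate
    keeps the constant. *)
Definition lipn n (f : 'rV[R]_n -> R) :=
  exists L, forall x y, `|f x - f y| <= L * norm1 (x - y).

(** The mean for the density [pi ^ (- n / 2) exp (- |x| ^ 2)], encoded by iterated integrals so that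
    its properties follow from those on the line by induction on [n]. *)
Fixpoint gmeann n : ('rV[R]_n -> R) -> R :=
  match n return ('rV[R]_n -> R) -> R with
  | 0 => fun f => f 0
  | n'.+1 => fun f => gmean (fun s => gmeann (fun x => f (vcons s x)))
  end.

Lemma eq_gmeann n (f h : 'rV[R]_n -> R) : f =1 h -> gmeann f = gmeann h.
Proof. by move=> /funext->. Qed.

Lemma gmeann_cst n c : gmeann (fun _ : 'rV[R]_n => c) = c.
Proof.
elim: n => [//|n IH] /=; under eq_gmean do rewrite IH; exact: gmean_cst.
Qed.

Lemma lipn_cst n c : lipn (fun _ : 'rV[R]_n => c).
Proof. by exists 0 => x y; rewrite subrr normr0 mul0r. Qed.

Lemma lipnD n (f h : 'rV[R]_n -> R) : lipn f -> lipn h -> lipn (fun x => f x + h x).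
Proof.
move=> [L fL] [M gM]; exists (L + M) => x y.
have -> : f x + h x - (f y + h y) = (f x - f y) + (h x - h y) by ring.
by rewrite mulrDl (le_trans (ler_normD _ _))// lerD.
Qed.

Lemma lipnZ n c (f : 'rV[R]_n -> R) : lipn f -> lipn (fun x => c * f x).
Proof.
move=> [L fL]; exists (`|c| * L) => x y.
by rewrite -mulrBr normrM -mulrA ler_wpM2l.
Qed.

Lemma lipn_sum n I (r : seq I) (F : I -> 'rV[R]_n -> R) :
  (forall i, lipn (F i)) -> lipn (fun x => \sum_(i <- r) F i x).
Proof.
move=> lF; elim: r => [|i r IH].
  under eq_fun do rewrite big_nil; exact: lipn_cst.
under eq_fun do rewrite big_cons; exact: lipnD.
Qed.

Lemma lipn_vcons n (f : 'rV[R]_n.+1 -> R) s : lipn f -> lipn (fun x => f (vcons s x)).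
Proof.
move=> [L fL]; exists L => x y; apply: (le_trans (fL _ _)).
by rewrite norm1_vcons subrr normr0 add0r.
Qed.

(** Proved together: monotonicity and additivity in one dimension make the partial mean Lipschitz
    (step [H]), and this gives both in the next dimension. *)
Lemma gmeann_props n :
  [/\ forall f h : 'rV[R]_n -> R, lipn f -> lipn h -> (forall x, f x <= h x) ->
        gmeann f <= gmeann h,
      forall f h : 'rV[R]_n -> R, lipn f -> lipn h ->
        gmeann (fun x => f x + h x) = gmeann f + gmeann h &
      forall f : 'rV[R]_n.+1 -> R, lipn f ->
        lip (fun s => gmeann (fun x => f (vcons s x)))].
Proof.
have H m : (forall f h : 'rV[R]_m -> R, lipn f -> lipn h -> (forall x, f x <= h x) ->
        gmeann f <= gmeann h) ->
      (forall f h : 'rV[R]_m -> R, lipn f -> lipn h ->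
        gmeann (fun x => f x + h x) = gmeann f + gmeann h) ->
      forall f : 'rV[R]_m.+1 -> R, lipn f ->
        lip (fun s => gmeann (fun x => f (vcons s x))).
  move=> le add f lf; have [L fL] := lf; exists L => s t.
  have {}fL s' t' x : f (vcons s' x) <= f (vcons t' x) + L * `|s' - t'|.
    rewrite -lerBlDl (le_trans (ler_norm _))// (le_trans (fL _ _))//.
    by rewrite norm1_vcons subrr norm1_0 addr0.
  have {}fL s' t' : gmeann (fun x => f (vcons s' x)) <=
      gmeann (fun x => f (vcons t' x)) + L * `|s' - t'|.
    rewrite -[X in _ + X](gmeann_cst m) -add; last 2 first.
    - exact: lipn_vcons.
    - exact: lipn_cst.
    apply: le => //; first exact: lipn_vcons.
    by apply: lipnD; [exact: lipn_vcons|exact: lipn_cst].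
  by have := fL s t; have := fL t s; rewrite (distrC t) ler_norml; lra.
elim: n => [|n [le add lp]].
  have le0 (f h : 'rV[R]_0 -> R) : lipn f -> lipn h -> (forall x, f x <= h x) ->
      gmeann f <= gmeann h by move=> _ _; exact.
  by split => //; exact: H.
have le' : forall f h : 'rV[R]_n.+1 -> R, lipn f -> lipn h -> (forall x, f x <= h x) ->
        gmeann f <= gmeann h.
  move=> f h lf lh fh /=; apply: gmean_le; [exact: lp|exact: lp|move=> s].
  by apply: le => //; exact: lipn_vcons.
have add' : forall f h : 'rV[R]_n.+1 -> R, lipn f -> lipn h ->
        gmeann (fun x => f x + h x) = gmeann f + gmeann h.
  move=> f h lf lh /=; rewrite -gmeanD; [|exact: lp|exact: lp].
  by apply: eq_gmean => s; rewrite add//; exact: lipn_vcons.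
by split => //; exact: H.
Qed.

Lemma gmeann_le n (f h : 'rV[R]_n -> R) : lipn f -> lipn h ->
  (forall x, f x <= h x) -> gmeann f <= gmeann h.
Proof. by have [le _ _] := gmeann_props n; exact: le. Qed.

Lemma gmeannD n (f h : 'rV[R]_n -> R) : lipn f -> lipn h ->
  gmeann (fun x => f x + h x) = gmeann f + gmeann h.
Proof. by have [_ add _] := gmeann_props n; exact: add. Qed.

Lemma lip_gmeann n (f : 'rV[R]_n.+1 -> R) : lipn f ->
  lip (fun s => gmeann (fun x => f (vcons s x))).
Proof. by have [_ _ lp] := gmeann_props n; exact: lp. Qed.

Lemma gmeannZ n c (f : 'rV[R]_n -> R) : lipn f ->
  gmeann (fun x => c * f x) = c * gmeann f.
Proof.
elim: n f => [//|n IH] f lf /=; rewrite -gmeanZ; last exact: lip_gmeann.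
by apply: eq_gmean => s; rewrite IH//; exact: lipn_vcons.
Qed.

Lemma gmeann_sum n I (r : seq I) (F : I -> 'rV[R]_n -> R) :
  (forall i, lipn (F i)) ->
  gmeann (fun x => \sum_(i <- r) F i x) = \sum_(i <- r) gmeann (F i).
Proof.
move=> lF; elim: r => [|i r IH].
  by rewrite big_nil; under eq_gmeann do rewrite big_nil; exact: gmeann_cst.
rewrite big_cons -IH -gmeannD//; last exact: lipn_sum.
by apply: eq_gmeann => x; rewrite big_cons.
Qed.

Lemma lipn_dotp n (F : R -> R) (v : 'rV[R]_n) : lip F -> lipn (fun x => F (dotp v x)).
Proof.
move=> [L FL]; exists (`|L| * norm1 v) => x y; apply: (le_trans (FL _ _)).
rewrite -dotpBr -mulrA.
apply: (@le_trans _ _ (`|L| * `|dotp v (x - y)|)); first by rewrite ler_wpM2r// ler_norm.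
rewrite ler_wpM2l// /norm1 mulr_suml (le_trans (ler_norm_sum _ _ _))//.
apply: ler_sum => i _; rewrite normrM ler_wpM2l// (bigD1 i)//= lerDl.
by apply: sumr_ge0.
Qed.

(** Rotation invariance in the form used: a linear form of a Gaussian vector is a Gaussian variable
    scaled by [|v|]. The induction merges the first coordinate with the others by [gmean_stable]. *)
Lemma gmeann_dotp n (F : R -> R) (v : 'rV[R]_n) : lip F -> (forall x, 0 <= F x) ->
  gmeann (fun x => F (dotp v x)) = gmean (fun z => F (enorm v * z)).
Proof.
elim: n F v => [|n IH] F v lF F0 /=.
  rewrite /enorm /dotp !big_ord0 sqrtr0.
  by under eq_gmean do rewrite mul0r; rewrite gmean_cst.
transitivity (gmean (fun s => gmean (fun t => F (enorm (vtail v) * t + v ord0 ord0 * s)))).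
  apply: eq_gmean => s.
  under eq_gmeann do rewrite dotp_vcons addrC.
  have lFs : lip (fun x => F (x + v ord0 ord0 * s)).
    have := lip_affine 1 (v ord0 ord0 * s) lF; congr lip.
    by apply/funext => z; rewrite mul1r.
  by rewrite (IH (fun x => F (x + v ord0 ord0 * s))).
rewrite gmean_stable//; last exact: enorm_ge0.
by rewrite sqr_enorm -dotp_vtail.
Qed.

Lemma lip_normr : lip (fun x : R => `|x|).
Proof. by exists 1 => x y; rewrite mul1r ler_dist_dist. Qed.

(** The averaging identity that turns total variation in random directions into Euclidean length. *)
Lemma gmeann_normr_dotp n (v : 'rV[R]_n) :
  gmeann (fun x => `|dotp v x|) = enorm v / Num.sqrt pi.
Proof.
rewrite (gmeann_dotp v lip_normr)// -gmean_normr -gmeanZ; last exact: lip_normr.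
by apply: eq_gmean => x; rewrite normrM ger0_norm// enorm_ge0.
Qed.
End Vec.

(** * Radial functions *)

Section Radial.
Variable R : realType.
Notation mu := (@lebesgue_measure R).
Notation g := (@gauss_fun R).

Lemma cauchy_schwarz n (x y : 'rV[R]_n) : dotp x y <= enorm x * enorm y.
Proof.
have [x0|x0] := eqVneq (enorm x) 0.
  by rewrite (enorm_eq0 x0) /dotp big1 ?mulr_ge0 ?enorm_ge0// => i _; rewrite mxE mul0r.
have [y0|y0] := eqVneq (enorm y) 0.
  by rewrite (enorm_eq0 y0) /dotp big1 ?mulr_ge0 ?enorm_ge0// => i _; rewrite mxE mulr0.
have xy0 : 0 < enorm x * enorm y.
  by rewrite mulr_gt0// lt_neqAle eq_sym ?x0 ?y0 enorm_ge0.
(* This square expands to [2 |x| |y| (|x| |y| - (x, y))]. *)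
have := dotp_ge0 (enorm y *: x - enorm x *: y).
rewrite !(dotpBl, dotpBr, dotpZl, dotpZr) (dotpC y x) -!sqr_enorm.
have -> : enorm y * (enorm y * enorm x ^+ 2 - enorm x * dotp x y) -
  enorm x * (enorm y * dotp x y - enorm x * enorm y ^+ 2) =
  2 * (enorm x * enorm y) * (enorm x * enorm y - dotp x y) by ring.
by rewrite pmulr_rge0 ?subr_ge0// mulr_gt0.
Qed.

Lemma ler_enormD n (x y : 'rV[R]_n) : enorm (x + y) <= enorm x + enorm y.
Proof.
rewrite -ler_sqr ?nnegrE ?addr_ge0 ?enorm_ge0// sqr_enorm dotpDl !dotpDr.
rewrite sqrrD -!sqr_enorm (dotpC y x); have := cauchy_schwarz x y; lra.
Qed.

Lemma enorm_le_norm1 n (x : 'rV[R]_n) : enorm x <= norm1 x.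
Proof.
have x0 : 0 <= norm1 x by apply: sumr_ge0.
rewrite -ler_sqr ?nnegrE ?enorm_ge0// sqr_enorm [leRHS]expr2 {1}/norm1 mulr_suml.
apply: ler_sum => i _; rewrite -expr2 -real_normK ?num_real// expr2 ler_wpM2l//.
by rewrite /norm1 (bigD1 i)//= lerDl sumr_ge0.
Qed.

Lemma lipn_enorm n (F : R -> R) : lip F -> lipn (fun x : 'rV[R]_n => F (enorm x)).
Proof.
move=> [L FL]; exists `|L| => x y; apply: (le_trans (FL _ _)).
apply: (@le_trans _ _ (`|L| * `|enorm x - enorm y|)); first by rewrite ler_wpM2r// ler_norm.
rewrite ler_wpM2l// (le_trans _ (enorm_le_norm1 _))//.
have H (u v : 'rV[R]_n) : enorm u - enorm v <= enorm (u - v).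
  by rewrite lerBlDr (le_trans _ (ler_enormD _ _))// subrK.
rewrite ler_norml H andbT lerNl opprB (le_trans (H _ _))//.
by rewrite -opprB -scaleN1r enormZ normrN normr1 mul1r.
Qed.

(** Freezing the first coordinate [s] of a radial function leaves a radial function of the other
    coordinates with this profile. *)
Lemma lip_sqrt_sqrD (F : R -> R) s : lip F -> lip (fun r => F (Num.sqrt (s ^+ 2 + r ^+ 2))).
Proof.
move=> [L FL]; exists `|L| => x y; apply: (le_trans (FL _ _)).
apply: (le_trans (ler_wpM2r (normr_ge0 _) (ler_norm L))); rewrite ler_wpM2l//.
have H (u v : R) : Num.sqrt (s ^+ 2 + u ^+ 2) - Num.sqrt (s ^+ 2 + v ^+ 2) <= `|u - v|.
  have sv : 0 <= s ^+ 2 + v ^+ 2 by rewrite addr_ge0 ?sqr_ge0.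
  have su : 0 <= s ^+ 2 + u ^+ 2 by rewrite addr_ge0 ?sqr_ge0.
  rewrite lerBlDr -ler_sqr ?nnegrE ?addr_ge0 ?sqrtr_ge0// sqrrD !sqr_sqrtr//.
  have vs : `|v| <= Num.sqrt (s ^+ 2 + v ^+ 2).
    by rewrite -sqrtr_sqr ler_wsqrtr// lerDr sqr_ge0.
  have uv := ler_wpM2l (normr_ge0 (u - v)) vs.
  have : (u - v) * v <= `|u - v| * `|v| by rewrite -normrM ler_norm.
  rewrite real_normK ?num_real//; lra.
by rewrite ler_norml H andbT lerNl opprB distrC.
Qed.

Lemma continuous_normX k : continuous (fun r : R => `|r| ^+ k).
Proof.
move=> x; apply: (@continuous_comp _ _ _ (fun r : R => `|r|) (fun r => r ^+ k)).
  exact: norm_continuous.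
exact: exprn_continuous.
Qed.

(* Polar coordinates by scaling alone: substitute [r = |s| y], exchange the
   integrals, then substitute [s = z / sqrt (1 + y ^ 2)].  The constant [C] is
   finite because the case [F = 1] has mean [1]. *)
Lemma gmeann_radial n : exists2 C : R, 0 <= C &
  forall F : R -> R, lip F -> (forall x, 0 <= F x) ->
  ((gmeann (fun x : 'rV[R]_n.+1 => F (enorm x)))%:E =
    C%:E * \int[mu]_r (F `|r| * `|r| ^+ n * g r)%:E)%E.
Proof.
elim: n => [|n [C C0 IH]].
  exists (Num.sqrt pi)^-1; first by rewrite invr_ge0 sqrtr_ge0.
  move=> F lF F0; rewrite -[gmeann _]/(gmean (fun s => F (enorm (vcons s (0 : 'rV[R]_0))))).
  have e s : enorm (vcons s (0 : 'rV[R]_0)) = `|s|.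
    by rewrite enorm_vcons sqr_enorm /dotp big_ord0 addr0 sqrtr_sqr.
  under eq_gmean do rewrite e; rewrite gmeanE; last first.
    have [L FL] := lF; exists `|L| => x y; apply: (le_trans (FL _ _)).
    apply: (le_trans (ler_wpM2r (normr_ge0 _) (ler_norm L))).
    by rewrite ler_wpM2l// ler_dist_dist.
  by congr (_ * _)%E; apply: eq_integral => r _; rewrite expr0 mulr1.
have cg := @continuous_gauss_fun R.
pose q (y : R) : R := Num.sqrt (1 + y ^+ 2).
have q1 (y : R) : 0 < 1 + y ^+ 2 by rewrite ltr_wpDr ?sqr_ge0//.
have q0 y : 0 < q y by rewrite sqrtr_gt0.
have q2 y : q y ^+ 2 = 1 + y ^+ 2 by rewrite sqr_sqrtr// ltW.
have cq : continuous q.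
  move=> y; apply: continuous_comp; last exact: sqrt_continuous.
  by apply: cvgD; [exact: cvg_cst|exact: exprn_continuous].
have mq : measurable_fun setT q by exact: continuous_measurable_fun.
(* The integral over the slope [y], which splits off as a constant; its finiteness is settled only
   after [key]. *)
pose B := (\int[mu]_y (`|y| ^+ n / q y ^+ n.+2)%:E)%E.
pose c : R := (Num.sqrt pi)^-1.
have c0 : 0 <= c by rewrite invr_ge0 sqrtr_ge0.
have B0 : (0 <= B)%E.
  by apply: integral_ge0 => y _; rewrite lee_fin divr_ge0 ?exprn_ge0// ltW.
have key F : lip F -> (forall x, 0 <= F x) ->
  ((gmeann (fun x : 'rV[R]_n.+2 => F (enorm x)))%:E =
    c%:E * (C%:E * (B * \int[mu]_r (F `|r| * `|r| ^+ n.+1 * g r)%:E)))%E.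
  move=> lF F0; have cF := lip_continuous lF.
  have mF : measurable_fun setT F by exact: continuous_measurable_fun.
  have lFe : lip (fun s => gmeann (fun x : 'rV[R]_n.+1 => F (enorm (vcons s x)))).
    by apply: (@lip_gmeann _ _ (fun x => F (enorm x))); exact: lipn_enorm.
  rewrite -[gmeann _]/(gmean (fun s => gmeann (fun x : 'rV[R]_n.+1 => F (enorm (vcons s x))))).
  rewrite gmeanE//; congr (_ * _)%E.
  (* Here [p = (s, y)]: for [r = |s| y], [sqrt (s ^ 2 + r ^ 2)] becomes [|s| q(y)] and [|r| ^ n dr]
     becomes [|s| ^ (n + 1) |y| ^ n dy]. *)
  pose H (p : R * R) := (F (`|p.1| * q p.2) * `|p.1| ^+ n.+1 * `|p.2| ^+ n * g (p.1 * q p.2))%:E.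
  have H0 p : (0 <= H p)%E.
    by rewrite lee_fin !mulr_ge0 ?exprn_ge0 ?gauss_fun_ge0.
  have mH : measurable_fun setT H.
    have mn : measurable_fun setT (fun p : R * R => `|p.1|).
      apply: (@measurableT_comp _ _ _ _ _ _ (fun x : R => `|x|)) => //.
    have mn2 : measurable_fun setT (fun p : R * R => `|p.2|).
      apply: (@measurableT_comp _ _ _ _ _ _ (fun x : R => `|x|)) => //.
    have mq2 : measurable_fun setT (fun p : R * R => q p.2).
      by apply: measurableT_comp => //.
    apply/measurable_EFinP; apply: measurable_funM; last first.
      apply: measurableT_comp; first exact: measurable_gauss_fun.
      exact: measurable_funM.
    apply: measurable_funM; last exact: measurable_funX.
    apply: measurable_funM; last exact: measurable_funX.
    by apply: measurableT_comp => //; exact: measurable_funM.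
  transitivity (\int[mu]_s (C%:E * \int[mu]_y H (s, y)))%E.
    apply: ge0_ae_eq_integral => //.
    - apply/measurable_EFinP/measurable_funM; last exact: measurable_gauss_fun.
      by apply: continuous_measurable_fun; exact: lip_continuous.
    - apply: measurable_funeM; exact: measurable_fun_fubini_tonelli_F.
    - move=> s _; rewrite lee_fin mulr_ge0 ?gauss_fun_ge0//.
      rewrite -(gmeann_cst n.+1 (0 : R)); apply: gmeann_le => //; first exact: lipn_cst.
      by apply: (@lipn_vcons _ _ (fun x => F (enorm x))); exact: lipn_enorm.
    - by move=> s _; rewrite mule_ge0//; exact: integral_ge0.
    (* The scaling by [|s|] degenerates only at [s = 0], a null set. *)
    exists [set 0]; split => //; first exact: lebesgue_measure_set1.
    apply: subsetCl => s s0 _.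
    have {}s0 : s != 0 by apply/eqP.
    have lFs := lip_sqrt_sqrD s lF.
    under eq_gmeann do rewrite enorm_vcons.
    rewrite EFinM (IH _ lFs)// -muleA; congr (_ * _)%E.
    have cI : continuous (fun r => F (Num.sqrt (s ^+ 2 + `|r| ^+ 2)) * `|r| ^+ n * g r).
      move=> r; apply: cvgM; last exact: cg.
      apply: cvgM; last exact: continuous_normX.
      apply: (@continuous_comp _ _ _ (fun r : R => `|r|) (fun r => F (Num.sqrt (s ^+ 2 + r ^+ 2)))).
        exact: norm_continuous.
      exact: lip_continuous.
    have I0 r : 0 <= F (Num.sqrt (s ^+ 2 + `|r| ^+ 2)) * `|r| ^+ n * g r.
      by rewrite !mulr_ge0 ?exprn_ge0 ?gauss_fun_ge0.
    rewrite -ge0_integralZr//; last 3 first.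
    - by apply/measurable_EFinP; exact: continuous_measurable_fun.
    - by move=> r _; rewrite lee_fin.
    - by rewrite lee_fin gauss_fun_ge0.
    under eq_integral do rewrite -EFinM.
    rewrite (@ge0_integral_affine _ (fun r => F (Num.sqrt (s ^+ 2 + `|r| ^+ 2)) * `|r| ^+ n * g r * g s) `|s| 0).
    - apply: eq_integral => y _; rewrite /H /= addr0; congr EFin.
      have -> : Num.sqrt (s ^+ 2 + `| `|s| * y| ^+ 2) = `|s| * q y.
        have sq0 : 0 <= `|s| * q y by rewrite mulr_ge0// ltW.
        rewrite -[RHS](ger0_norm sq0) -[RHS]sqrtr_sqr; congr (Num.sqrt _).
        rewrite real_normK ?num_real// !exprMn q2 real_normK ?num_real//; ring.
      have -> : g (s * q y) = g (`|s| * y) * g s.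
        rewrite /gauss_fun -expRD; congr expR.
        rewrite !exprMn q2 real_normK ?num_real//; ring.
      rewrite normrM normr_id exprMn exprS; ring.
    - by rewrite normr_gt0.
    - by move=> r; apply: cvgM; [exact: cI|exact: cvg_cst].
    - by move=> r; rewrite mulr_ge0 ?gauss_fun_ge0.
  rewrite ge0_integralZl//; last 2 first.
  - exact: measurable_fun_fubini_tonelli_F.
  - by move=> s _; exact: integral_ge0.
  congr (_ * _)%E; rewrite (ge0_lebesgue_fubini mH H0).
  pose J := (\int[mu]_r (F `|r| * `|r| ^+ n.+1 * g r)%:E)%E.
  have cJ : continuous (fun r => F `|r| * `|r| ^+ n.+1 * g r).
    move=> r; apply: cvgM; last exact: cg.
    apply: cvgM; last exact: continuous_normX.
    apply: (@continuous_comp _ _ _ (fun r : R => `|r|) F); first exact: norm_continuous.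
    exact: cF.
  have J0 r : 0 <= F `|r| * `|r| ^+ n.+1 * g r.
    by rewrite !mulr_ge0 ?exprn_ge0 ?gauss_fun_ge0.
  (* Rescaling [s] by [q y] yields [n + 1] powers from [|s| ^ (n + 1)] and one more from [ds], hence
     the exponent [n.+2]. *)
  transitivity (\int[mu]_y ((`|y| ^+ n / q y ^+ n.+2)%:E * J))%E.
    apply: eq_integral => y _.
    rewrite /J (@ge0_integral_affine _ _ (q y) 0 (q0 y) cJ J0).
    rewrite -ge0_integralZl//; last 3 first.
    - apply/measurable_EFinP/measurable_funM => //.
      apply: continuous_measurable_fun => x.
      apply: (@continuous_comp _ _ _ (fun s => q y * s + 0) (fun r => F `|r| * `|r| ^+ n.+1 * g r)).
        exact: continuous_affine.
      exact: cJ.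
    - by move=> s _; rewrite lee_fin mulr_ge0// ltW.
    - by rewrite lee_fin divr_ge0 ?exprn_ge0// ltW.
    apply: eq_integral => s _; rewrite /H /= -EFinM; congr EFin.
    rewrite addr0 normrM (gtr0_norm (q0 y)) exprMn (mulrC s) (mulrC `|s|).
    rewrite (exprS (q y) n.+1); have := exprn_gt0 n.+1 (q0 y); have := q0 y.
    move: (q y ^+ n.+1) (`|s| ^+ n.+1) (g _) => u v w q_gt0 u_gt0.
    by field; rewrite !gt_eqF.
  rewrite ge0_integralZr//.
  - apply/measurable_EFinP; apply: continuous_measurable_fun => y.
    apply: cvgM; first exact: continuous_normX.
    apply: cvgV; first by rewrite gt_eqF// exprn_gt0.
    apply: (@continuous_comp _ _ _ q (fun x => x ^+ n.+2)); first exact: cq.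
    exact: exprn_continuous.
  - by move=> y _; rewrite lee_fin divr_ge0 ?exprn_ge0// ltW.
  - by apply: integral_ge0 => r _; rewrite lee_fin.
(* For [F = 1] the left side is [1], while an infinite [B] would make the right side [0] or
   infinite. *)
have Bfin : B \is a fin_num.
  rewrite ge0_fin_numE// ltNge leye_eq; apply/negP => /eqP By.
  have := key (fun=> 1) (lip_cst 1) (fun=> ler01); rewrite gmeann_cst By.
  set J := (\int[mu]_r _)%E.
  have : (0 <= J)%E by apply: integral_ge0 => r _; rewrite lee_fin !mulr_ge0 ?exprn_ge0 ?gauss_fun_ge0.
  rewrite le_eqVlt => /predU1P[<-|J0]; first by rewrite !mule0 => -[/eqP]; rewrite oner_eq0.
  rewrite gt0_mulye// muleA -EFinM.
  have : 0 <= c * C by rewrite mulr_ge0.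
  rewrite le_eqVlt => /predU1P[<-|cC]; first by rewrite mul0e => -[/eqP]; rewrite oner_eq0.
  by rewrite gt0_muley.
exists (c * (C * fine B)); first by rewrite !mulr_ge0// fine_ge0.
by move=> F lF F0; rewrite key// !EFinM fineK// !muleA.
Qed.
End Radial.

(** * The mean norm of a Gaussian vector *)

Section GammaFun.
Variable R : realType.
Notation mu := (@lebesgue_measure R).
Notation g := (@gauss_fun R).

(** The substitution [t = x ^ 2], made on [[0, n]] and carried to the half-line by monotone
    convergence. *)
Lemma integral_halfline_sqr (G : R -> R) : continuous G -> (forall x, 0 <= x -> 0 <= G x) ->
  (\int[mu]_(x in `[0%R, +oo[) (G x)%:E = \int[mu]_(x in `[0%R, +oo[) (G (x ^+ 2) * (2 * x))%:E)%E.
Proof.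
move=> cG G0.
pose F (x : R^o) : R^o := x ^+ 2.
have F'E : F^`()%classic = (fun x => 2 * x).
  apply/funext => x; rewrite /F derive1E exp_derive /= expr1 /GRing.scale /=; ring.
have cF : continuous F by exact: exprn_continuous.
have cF' : continuous F^`()%classic.
  rewrite F'E => x; have := @continuous_affine R 2 0 x.
  by congr continuous_at; apply/funext => z; rewrite addr0.
have cH : continuous (fun x : R => G (x ^+ 2) * (2 * x)).
  move=> x; apply: cvgM; last by have := cF' x; rewrite F'E.
  by apply: (@continuous_comp _ _ _ F G); [exact: cF|exact: cG].
have fin n : (\int[mu]_(x in `[0%R, (n * n)%N%:R]) (G x)%:E =
    \int[mu]_(x in `[0%R, n%:R]) (G (x ^+ 2) * (2 * x))%:E)%E.
  have e0 : F 0 = 0 by rewrite /F expr0n.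
  have en : F n%:R = (n * n)%N%:R by rewrite /F natrM.
  have := @integration_by_substitution_increasing R F G 0 n%:R (ler0n _ _).
  rewrite e0 en => ->.
  - by apply: eq_integral => x _; rewrite F'E.
  - move=> x y; rewrite !in_itv/= => /andP[x0 _] /andP[y0 _] xy.
    by rewrite /F ltr_pXn2r.
  - by move=> x _; exact: cF'.
  - by apply/cvg_ex; exists (F^`()%classic 0); apply: cvg_at_right_filter; exact: cF'.
  - by apply/cvg_ex; exists (F^`()%classic n%:R); apply: cvg_at_left_filter; exact: cF'.
  - split; [|by apply: cvg_at_right_filter; exact: cF|by apply: cvg_at_left_filter; exact: cF].
    by move=> x _; exact: exprn_derivable.
  - exact: continuous_subspaceT.
have half (K : R -> R) : continuous K -> (forall x, 0 <= x -> 0 <= K x) ->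
    (\int[mu]_(x in `[0%R, n%:R]) (K x)%:E @[n --> \oo] --> \int[mu]_(x in `[0%R, +oo[) (K x)%:E)%E.
  move=> cK K0.
  (* The even extension of [K], which is nonnegative on the whole line. *)
  pose K' (x : R) := K `|x|.
  have mK' : measurable_fun setT K'.
    apply: continuous_measurable_fun => x.
    by apply: (@continuous_comp _ _ _ (fun x : R => `|x|) K); [exact: norm_continuous|exact: cK].
  have := @ge0_cvgn_integral R mu K' (fun x => K0 _ (normr_ge0 x)) mK'.
  have e0 : (\int[mu]_(x in `[0%R, +oo[) (K' x)%:E = \int[mu]_(x in `[0%R, +oo[) (K x)%:E)%E.
    apply: eq_integral => x; rewrite inE/= in_itv/= andbT => x0.
    by rewrite /K' ger0_norm.
  have en (n : nat) : (\int[mu]_(x in `[0%R, n%:R]) (K' x)%:E = \int[mu]_(x in `[0%R, n%:R]) (K x)%:E)%E.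
    apply: eq_integral => x.
    by rewrite inE/= in_itv/= => /andP[x0 _]; rewrite /K' ger0_norm.
  by rewrite e0; under eq_fun do rewrite en.
have h1 := half _ cG G0.
(* On the [t] side the intervals end at [n ^ 2], so the limit is taken along a subsequence. *)
have {}h1 : (\int[mu]_(x in `[0%R, (n * n)%N%:R]) (G x)%:E @[n --> \oo] --> \int[mu]_(x in `[0%R, +oo[) (G x)%:E)%E.
  apply: (@cvg_comp _ _ _ (fun n : nat => (n * n)%N)
    (fun n : nat => (\int[mu]_(x in `[0%R, n%:R]) (G x)%:E)%E) _ _ _ _ h1).
  apply/cvgnyPge => m; near=> n.
  have : (m <= n)%N by near: n; exact: nbhs_infty_ge.
  have sq (p : nat) : (p <= p * p)%N by case: p => // p; exact: leq_pmulr.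
  by move=> /leq_trans; apply.
have h2 := half _ cH.
move: h1; under eq_fun do rewrite fin.
move=> /cvg_lim <-//; apply/cvg_lim => //; apply: h2 => x x0.
by rewrite mulr_ge0// ?mulr_ge0// G0// sqr_ge0.
Unshelve. all: by end_near. Qed.

(** Putting [t = r ^ 2] turns [t ^ (k / 2) exp (- t) dt] into [2 r ^ (k + 1) exp (- r ^ 2) dr]; the
    factor 2 unfolds the half-line to the line. *)
Lemma integral_Gamma k :
  (\int[mu]_(t in `]0%R, +oo[) (t `^ ((k.+2)%:R / 2 - 1) * expR (- t))%:E =
   \int[mu]_r (`|r| ^+ k.+1 * g r)%:E)%E.
Proof.
have cn := @continuous_normX R.
(* Powers of the square root replace [powR], to have an integrand continuous on the whole line. *)
pose G t : R := Num.sqrt t ^+ k * expR (- t).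
have cG : continuous G.
  move=> x; apply: cvgM.
    apply: (@continuous_comp _ _ _ Num.sqrt (fun r => r ^+ k)).
      exact: sqrt_continuous.
    exact: exprn_continuous.
  apply: continuous_comp; first exact: opp_continuous.
  exact: continuous_expR.
transitivity (\int[mu]_(t in `[0%R, +oo[) (G t)%:E)%E.
  rewrite -integral_itv_obnd_cbnd; last first.
    by apply/measurable_EFinP; apply: measurable_funTS; exact: continuous_measurable_fun.
  apply: eq_integral => t; rewrite inE/= in_itv/= andbT => t0.
  have -> : k.+2%:R / 2 - 1 = 2^-1 * k%:R :> R by rewrite -addn2 natrD; field.
  by rewrite powRrM powR12_sqrt ?(ltW t0)// powR_mulrn ?sqrtr_ge0.
rewrite integral_halfline_sqr//; last first.
  by move=> x _; rewrite mulr_ge0 ?exprn_ge0 ?sqrtr_ge0 ?expR_ge0.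
rewrite ge0_symfun_integralT//=; last 3 first.
- by move=> x; rewrite mulr_ge0 ?exprn_ge0 ?gauss_fun_ge0.
- by move=> x; apply: cvgM; [exact: cn|exact: continuous_gauss_fun].
- by move=> x /=; rewrite normrN /gauss_fun sqrrN.
have -> : [set x : R | 0 <= x] = `[0, +oo[%classic.
  by apply/seteqP; split => x/=; rewrite in_itv/= andbT.
rewrite -ge0_integralZl//; last 2 first.
- apply/measurable_EFinP; apply: measurable_funTS; apply: continuous_measurable_fun => x.
  by apply: cvgM; [exact: cn|exact: continuous_gauss_fun].
- by move=> x _; rewrite lee_fin mulr_ge0 ?exprn_ge0 ?gauss_fun_ge0.
apply: eq_integral => x; rewrite inE/= in_itv/= andbT => x0.
rewrite -EFinM /G sqrtr_sqr ger0_norm// /gauss_fun (exprS x k); congr EFin; ring.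
Qed.

Definition rho n : R := gmeann (fun x : 'rV[R]_n => enorm x).

(** The quotient of the radial formulas for the norm and for the constant [1], in which [C]
    cancels. *)
Lemma rhoE n : (2 <= n)%N -> rho n = Gamma ((n%:R + 1) / 2 : R) / Gamma (n%:R / 2 : R).
Proof.
case: n => [//|[//|n]] _.
have [C C0 radC] := gmeann_radial R n.+1.
have := radC (fun=> 1) (lip_cst 1) (fun=> ler01); rewrite gmeann_cst.
have := radC (fun x => `|x|) (lip_normr R) (fun x => normr_ge0 x).
under eq_integral do rewrite normr_id -exprS.
under [in X in _ -> X -> _]eq_integral do rewrite mul1r.
rewrite -!integral_Gamma /Gamma /Rintegral -(natr1 n.+2).
under eq_gmeann do rewrite ger0_norm ?enorm_ge0//.
rewrite -/(rho n.+2).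
set I1 := (\int[mu]_(t in _) _)%E; set I0 := (\int[mu]_(t in _) _)%E.
have I1_ge0 : (0 <= I1)%E.
  by apply: integral_ge0 => t _; rewrite lee_fin mulr_ge0 ?powR_ge0 ?expR_ge0.
have I0_ge0 : (0 <= I0)%E.
  by apply: integral_ge0 => t _; rewrite lee_fin mulr_ge0 ?powR_ge0 ?expR_ge0.
move: C0; rewrite le_eqVlt => /predU1P[<- _|C_gt0].
  by rewrite mul0e => -[/eqP]; rewrite oner_eq0.
(* A finite mean and [C > 0] force a finite integral, so [fine] loses nothing. *)
have finI (I : \bar R) (a : R) : (0 <= I)%E -> a%:E = (C%:E * I)%E ->
    a = C * fine I.
  by case: I => [r _ [->]|_|//] //; rewrite gt0_muley.
move=> /(finI _ _ I1_ge0) -> /(finI _ _ I0_ge0) C0E.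
have i0 : fine I0 != 0 by apply: contra_eq_neq C0E => ->; rewrite mulr0 oner_eq0.
by apply: (mulIf i0); rewrite divfK// mulrAC -C0E mul1r.
Qed.

Lemma lipn_norm n : lipn (fun x : 'rV[R]_n => enorm x).
Proof. by apply: (@lipn_enorm _ _ id); exists 1 => x y; rewrite mul1r. Qed.

Lemma rho_ge0 n : 0 <= rho n.
Proof.
rewrite -(gmeann_cst n (0 : R)); apply: gmeann_le; first exact: lipn_cst.
  exact: lipn_norm.
by move=> x; exact: enorm_ge0.
Qed.

(** * Mean norms in consecutive dimensions *)

Lemma rho1 : rho 1 = (Num.sqrt pi)^-1.
Proof.
have e : enorm (const_mx 1 : 'rV[R]_1) = 1.
  by rewrite /enorm /dotp big_ord1 mxE mulr1 sqrtr1.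
rewrite -[RHS]mul1r -e -gmeann_normr_dotp; apply: eq_gmeann => x.
by rewrite /enorm /dotp !big_ord1 mxE mul1r -expr2 sqrtr_sqr.
Qed.

Definition omit n (j : 'I_n) (x : 'rV[R]_n) : 'rV[R]_n :=
  \row_i (if i == j then 0 else x ord0 i).

Lemma dotp_omit n (j : 'I_n) (x : 'rV[R]_n) :
  dotp (omit j x) (omit j x) = dotp x x - x ord0 j ^+ 2.
Proof.
rewrite /dotp (bigD1 j)//= [in RHS](bigD1 j)//= !mxE eqxx mul0r add0r.
rewrite expr2 [in RHS]addrAC subrr add0r; apply: eq_bigr => i /negbTE ij.
by rewrite mxE ij.
Qed.

Lemma gmeannS n (f : 'rV[R]_n.+1 -> R) :
  gmeann f = gmean (fun s => gmeann (fun x => f (vcons s x))).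
Proof. by []. Qed.

(** Dropping a coordinate of a Gaussian vector leaves a Gaussian vector of dimension [n]. An
    arbitrary [F] lets the induction absorb the first coordinate as a shift by [s ^ 2]. *)
Lemma gmeann_omit n (F : R -> R) (j : 'I_n.+1) :
  gmeann (fun x : 'rV[R]_n.+1 => F (dotp x x - x ord0 j ^+ 2)) =
  gmeann (fun x : 'rV[R]_n => F (dotp x x)).
Proof.
elim: n F j => [|n IH] F j; rewrite gmeannS.
  rewrite (ord1 j) /=.
  under eq_gmean do rewrite dotp_vcons2 vcons0 addrC addKr.
  exact: gmean_cst.
case: (unliftP ord0 j) => [i|] ->.
  rewrite [RHS]gmeannS; apply: eq_gmean => s.
  rewrite [RHS](eq_gmeann (h := fun x => F (s ^+ 2 + dotp x x))); last first.
    by move=> x; rewrite dotp_vcons2.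
  rewrite -(IH (fun r => F (s ^+ 2 + r)) i); apply: eq_gmeann => x.
  by rewrite dotp_vcons2 vconsS addrA.
rewrite -[RHS]gmean_cst; apply: eq_gmean => s; apply: eq_gmeann => x.
by rewrite dotp_vcons2 vcons0 addrC addKr.
Qed.

Lemma lipn_omit n (j : 'I_n) : lipn (fun x : 'rV[R]_n => enorm (omit j x)).
Proof.
have [L enL] := lipn_norm n; exists `|L| => x y.
apply: (le_trans (enL _ _)).
apply: (@le_trans _ _ (`|L| * norm1 (omit j x - omit j y))).
  by rewrite ler_wpM2r ?ler_norm// sumr_ge0.
rewrite ler_wpM2l//; apply: ler_sum => i _; rewrite !mxE.
by case: ifP => _ //; rewrite subr0 normr0.
Qed.

(* Pointwise, [sum_j |omit j x| >= n |x|]. *)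
Lemma rho_succ n : n%:R * rho n.+1 <= n.+1%:R * rho n.
Proof.
rewrite /rho -gmeannZ; last exact: lipn_norm.
apply: (@le_trans _ _ (gmeann (fun x : 'rV[R]_n.+1 => \sum_j enorm (omit j x)))).
  apply: gmeann_le.
  - by apply: lipnZ; exact: lipn_norm.
  - by apply: lipn_sum => j; exact: lipn_omit.
  move=> x; have [x0|x0] := eqVneq (enorm x) 0.
    by rewrite x0 mulr0 sumr_ge0// => j _; exact: enorm_ge0.
  have {}x0 : 0 < enorm x by rewrite lt_neqAle eq_sym x0 enorm_ge0.
  (* After multiplication by [|x|], each term dominates [|omit j x| ^ 2], and these squares add up
     to [n |x| ^ 2]. *)
  rewrite -(ler_pM2r x0) mulr_suml.
  apply: (@le_trans _ _ (\sum_(j < n.+1) dotp (omit j x) (omit j x))).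
    under eq_bigr do rewrite dotp_omit.
    rewrite sumrB sumr_const card_ord -mulrA -expr2 sqr_enorm.
    have -> : \sum_(i < n.+1) x ord0 i ^+ 2 = dotp x x.
      by apply: eq_bigr => i _; rewrite expr2.
    rewrite -[X in _ <= X - _]mulr_natl -natr1; lra.
  apply: ler_sum => j _; rewrite -sqr_enorm expr2 ler_wpM2l ?enorm_ge0//.
  by rewrite ler_sqrt ?dotp_ge0// dotp_omit lerBlDr lerDl sqr_ge0.
rewrite gmeann_sum; last by move=> j; exact: lipn_omit.
rewrite (eq_bigr (fun=> gmeann (fun x : 'rV[R]_n => enorm x))).
  by rewrite sumr_const card_ord mulr_natl.
move=> j _; rewrite -(gmeann_omit Num.sqrt j); apply: eq_gmeann => x.
by rewrite /enorm dotp_omit.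
Qed.

Lemma normrDB_ge (u v : R) : 2 * `|u| <= `|u + v| + `|u - v|.
Proof.
have : `|(u + v) + (u - v)| <= `|u + v| + `|u - v| by exact: ler_normD.
have -> : (u + v) + (u - v) = 2 * u by ring.
by rewrite normrM normr_nat.
Qed.

(* The forms on the right are the scalar products with six unit vectors spanning
   lines at angles multiple of [pi / 6]; their sum is at least [cot (pi / 12)]
   times the norm. *)
Lemma six_directions (t a b : R) : 0 <= t -> t ^+ 2 = 3 ->
  (2 + t) * Num.sqrt (a ^+ 2 + b ^+ 2) <=
  `|a| + `|b| + (`|t / 2 * a + 2^-1 * b| + `|t / 2 * a - 2^-1 * b|)
  + (`|2^-1 * a + t / 2 * b| + `|2^-1 * a - t / 2 * b|).
Proof.
move=> t0 t3.
have h1 := normrDB_ge (t / 2 * a) (2^-1 * b).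
have h2 := normrDB_ge (2^-1 * b) (t / 2 * a).
have h3 := normrDB_ge (2^-1 * a) (t / 2 * b).
have h4 := normrDB_ge (t / 2 * b) (2^-1 * a).
rewrite (addrC (2^-1 * b)) (distrC (2^-1 * b)) in h2.
rewrite (addrC (t / 2 * b)) (distrC (t / 2 * b)) in h4.
have th : 0 <= t / 2 by rewrite divr_ge0.
have hh : 0 <= 2^-1 :> R by rewrite invr_ge0.
have e1 (z : R) : `|t / 2 * z| = t / 2 * `|z| by rewrite normrM ger0_norm.
have e2 (z : R) : `|2^-1 * z| = 2^-1 * `|z| by rewrite normrM ger0_norm.
rewrite e1 in h1; rewrite e2 in h2; rewrite e2 in h3; rewrite e1 in h4.
move: h1 h2 h3 h4; set X := `|t / 2 * a + _| + _; set Y := `|2^-1 * a + _| + _.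
move=> h1 h2 h3 h4.
have A0 := normr_ge0 a; have B0 := normr_ge0 b.
have aA : a ^+ 2 = `|a| ^+ 2 by rewrite real_normK ?num_real.
have bB : b ^+ 2 = `|b| ^+ 2 by rewrite real_normK ?num_real.
have H (S' : R) : 0 <= S' -> S' <= `|a| + `|b| + X + Y ->
    0 <= S' ^+ 2 - (2 + t) ^+ 2 * (`|a| ^+ 2 + `|b| ^+ 2) ->
    (2 + t) * Num.sqrt (a ^+ 2 + b ^+ 2) <= `|a| + `|b| + X + Y.
  move=> S0 S'S; rewrite subr_ge0 => SS; apply: le_trans S'S.
  rewrite aA bB -ler_sqr ?nnegrE ?mulr_ge0 ?addr_ge0 ?sqrtr_ge0//.
  by rewrite exprMn sqr_sqrtr// addr_ge0 ?sqr_ge0.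
move: {aA bB e1 e2} `|a| `|b| A0 B0 H h1 h2 h3 h4 => A B A0 B0 H h1 h2 h3 h4.
have tA0 : 0 <= t * A by rewrite mulr_ge0.
have tB0 : 0 <= t * B by rewrite mulr_ge0.
(* Three sectors: the angle of [(A, B)] is at most [pi / 6], at least [pi / 3], or in between. In
   each, [|u + v| + |u - v| >= 2 max (|u|, |v|)] gives a linear lower bound, and the difference of
   squares factors with zeros on the edges of the sector. *)
have [tBA|tBA] := lerP (t * B) A.
  apply: (H ((2 + t) * A + B)); [lra|lra|].
  have -> : ((2 + t) * A + B) ^+ 2 - (2 + t) ^+ 2 * (A ^+ 2 + B ^+ 2) =
     (4 + 2 * t) * B * (A - t * B) by ring: t3.
  by rewrite !mulr_ge0 ?subr_ge0//; lra.
have [tAB|tAB] := lerP (t * A) B.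
  apply: (H ((2 + t) * B + A)); [lra|lra|].
  have -> : ((2 + t) * B + A) ^+ 2 - (2 + t) ^+ 2 * (A ^+ 2 + B ^+ 2) =
     (4 + 2 * t) * A * (B - t * A) by ring: t3.
  by rewrite !mulr_ge0 ?subr_ge0//; lra.
apply: (H ((1 + t) * (A + B))); [lra|lra|].
have -> : ((1 + t) * (A + B)) ^+ 2 - (2 + t) ^+ 2 * (A ^+ 2 + B ^+ 2) =
   (2 + t) * (t * A - B) * (t * B - A) by ring: t3.
by rewrite !mulr_ge0 ?subr_ge0 ?ltW//; lra.
Qed.
(** Averages [six_directions]; each of the six forms has mean [1 / sqrt pi]. *)
Lemma rho2_le : rho 2 * (2 + Num.sqrt 3) <= 6 / Num.sqrt pi.
Proof.
pose t : R := Num.sqrt 3.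
have t0 : 0 <= t by exact: sqrtr_ge0.
have t3 : t ^+ 2 = 3 by rewrite sqr_sqrtr.
pose vec (a b : R) : 'rV[R]_2 := vcons a (vcons b 0).
have dotE a b (x : 'rV[R]_2) : dotp (vec a b) x = a * x ord0 ord0 + b * x ord0 (lift ord0 ord0).
  by rewrite /dotp big_ord_recl big_ord1 vcons0 vconsS vcons0.
have norm_vec a b : a ^+ 2 + b ^+ 2 = 1 -> enorm (vec a b) = 1.
  by move=> ab; rewrite /enorm dotE vconsS !vcons0 -!expr2 ab sqrtr1.
pose vs := [:: vec 1 0; vec 0 1; vec (t / 2) 2^-1; vec (t / 2) (- 2^-1);
   vec 2^-1 (t / 2); vec 2^-1 (- (t / 2))].
have lvs v : lipn (fun x : 'rV[R]_2 => `|dotp v x|).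
  exact: (lipn_dotp v (lip_normr R)).
have mean_vs : gmeann (fun x : 'rV[R]_2 => \sum_(v <- vs) `|dotp v x|) = 6 / Num.sqrt pi.
  rewrite gmeann_sum// (eq_bigr _ (fun v _ => gmeann_normr_dotp v)).
  by rewrite /vs !big_cons big_nil !norm_vec;
    rewrite ?sqrrN ?expr_div_n ?exprVn ?t3 ?expr0n ?expr1n /=;
    first [lra|field].
rewrite -mean_vs mulrC -gmeannZ; last exact: lipn_norm.
apply: gmeann_le.
- by apply: lipnZ; exact: lipn_norm.
- by apply: lipn_sum => v; exact: lvs.
move=> x; rewrite /vs !big_cons big_nil !dotE.
set a := x ord0 ord0; set b := x ord0 (lift ord0 ord0).
have -> : enorm x = Num.sqrt (a ^+ 2 + b ^+ 2).
  by rewrite /enorm /dotp big_ord_recl big_ord1 -!expr2.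
have := @six_directions t a b t0 t3.
rewrite -/t !mulNr !mul1r !mul0r addr0 add0r; lra.
Qed.

(** The target factor is at most [3 / 8]. From dimension 3 on, [rho_succ] gives a ratio of at least
    [2 / 3], and [4 / 9 > 3 / 8]. Between dimensions 2 and 1 it would give only [1 / 2], so
    [rho2_le] is used, with the ratio [37 / 60] obtained from [sqrt 3 >= 17 / 10]. *)
Lemma rho_ratio n : (1 - 2 / pi) * rho n.+2 ^+ 2 <= rho n.+1 ^+ 2.
Proof.
have pi0 := pi_gt0 R; have pi_lt := pi_lt_16_5 R.
have r0 := rho_ge0 n.+2.
have pi38 : 1 - 2 / pi <= 3 / 8 :> R.
  have : (16 / 5 : R)^-1 <= pi^-1 by rewrite lef_pV2 ?posrE ?ltW//; lra.
  lra.
apply: (@le_trans _ _ (3 / 8 * rho n.+2 ^+ 2)); first by rewrite ler_wpM2r ?sqr_ge0.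
case: n r0 => [|n] r0.
  have s3 : 17 / 10 <= Num.sqrt 3 :> R.
    rewrite -[leLHS]ger0_norm; last lra.
    by rewrite -sqrtr_sqr ler_wsqrtr//; lra.
  have h : 37 / 60 * rho 2 <= rho 1.
    have : rho 2 * (37 / 10) <= rho 2 * (2 + Num.sqrt 3) by rewrite ler_wpM2l//; lra.
    move=> /le_trans /(_ rho2_le); rewrite -rho1; lra.
  have : (37 / 60 * rho 2) ^+ 2 <= rho 1 ^+ 2.
    by rewrite ler_sqr ?nnegrE ?rho_ge0// mulr_ge0//; lra.
  by rewrite exprMn; have := sqr_ge0 (rho 2); lra.
have h : 2 / 3 * rho n.+3 <= rho n.+2.
  have := rho_succ n.+2; have n0 : (0 : R) <= n%:R by rewrite ler0n.
  have -> : n.+3%:R = n%:R + 3 :> R by rewrite -addn3 natrD.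
  have -> : n.+2%:R = n%:R + 2 :> R by rewrite -addn2 natrD.
  have r1 := rho_ge0 n.+2.
  have := mulr_ge0 n0 r0; have := mulr_ge0 n0 r1.
  move=> p1 p2 le; rewrite leNgt; apply/negP => lt.
  have : (n%:R + 3) * rho n.+2 < (n%:R + 3) * (2 / 3 * rho n.+3).
    by rewrite ltr_pM2l//; lra.
  lra.
have : (2 / 3 * rho n.+3) ^+ 2 <= rho n.+2 ^+ 2.
  by rewrite ler_sqr ?nnegrE ?rho_ge0// mulr_ge0//; lra.
by rewrite exprMn; have := sqr_ge0 (rho n.+3); lra.
Qed.
End GammaFun.

(** * Polygons around a body of constant width *)

Section Geometry.
Variable R : realType.

Lemma dist_le_variation (y : nat -> R) i j : (i <= j)%N ->
  `|y i - y j| <= \sum_(i <= k < j) `|y k - y k.+1|.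
Proof.
elim: j => [|j IH]; first by rewrite leqn0 => /eqP->; rewrite subrr normr0 big_geq.
rewrite leq_eqVlt => /predU1P[->|ij]; first by rewrite subrr normr0 big_geq.
rewrite big_nat_recr//=; apply: (le_trans (ler_distD (y j) _ _)).
by rewrite lerD2r IH.
Qed.

(** A path from [y 0] to [y m] through both values covers the gap between them once directly, and
    once more, up to [|y 0 - y m|], on its two outer stretches. *)
Lemma variation_ge (y : nat -> R) m p q : (p <= m)%N -> (q <= m)%N ->
  2 * (y p - y q) - `|y 0%N - y m| <= \sum_(k < m) `|y k - y k.+1|.
Proof.
rewrite -(big_mkord xpredT (fun k => `|y k - y k.+1|)).
have H i j : (i <= j <= m)%N ->
    `|y 0%N - y i| + `|y i - y j| + `|y j - y m| <=
    \sum_(0 <= k < m) `|y k - y k.+1|.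
  move=> /andP[ij jm]; rewrite (big_cat_nat (n := i)) ?(leq_trans ij)//=.
  rewrite (big_cat_nat (n := j) (m := i))//= addrA.
  by rewrite !lerD// dist_le_variation.
move=> pm qm.
have e1 := ler_norm (y p - y q).
have [pq|/ltnW qp] := leqP p q.
  apply: le_trans (H p q _); last by rewrite pq.
  have : `|y p - y q| <= `|y 0%N - y p| + `|y 0%N - y m| + `|y q - y m|.
    have := ler_distD (y 0%N) (y p) (y q); have := ler_distD (y m) (y 0%N) (y q).
    rewrite (distrC (y p) (y 0%N)) (distrC (y m) (y q)); lra.
  lra.
apply: le_trans (H q p _); last by rewrite qp.
have : `|y q - y p| <= `|y 0%N - y q| + `|y 0%N - y m| + `|y p - y m|.
  have := ler_distD (y 0%N) (y q) (y p); have := ler_distD (y m) (y 0%N) (y p).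
  rewrite (distrC (y q) (y 0%N)) (distrC (y m) (y p)); lra.
rewrite (distrC (y q) (y p)); lra.
Qed.

Lemma exists_argmax (y : nat -> R) m :
  exists2 p, (p <= m)%N & forall i, (i <= m)%N -> y i <= y p.
Proof.
elim: m => [|m [p pm yp]]; first by exists 0%N => // i; rewrite leqn0 => /eqP->.
have [h|h] := leP (y m.+1) (y p).
  exists p; first exact: leqW.
  by move=> i; rewrite leq_eqVlt => /predU1P[->//|]; exact: yp.
exists m.+1 => // i; rewrite leq_eqVlt => /predU1P[->//|/yp/le_trans]; apply.
exact: ltW.
Qed.

Definition net n (S : set 'rV[R]_n) (P : nat -> 'rV[R]_n) m (e : R) :=
  forall x, S x -> exists2 i, (i <= m)%N & enorm (x - P i) <= e.

(** A linear form on the hull is bounded by its values on [S], and these exceed the maximum over the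
    net by at most [e]. *)
Lemma support_net n (K S : set 'rV[R]_n) P m e (u : 'rV[R]_n) :
  K !=set0 -> K `<=` co S -> net S P m e -> dotp u u = 1 ->
  exists2 p, (p <= m)%N & support_fun K u <= dotp (P p) u + e.
Proof.
move=> K0 KS PS u1; have [p pm Pp] := exists_argmax (fun i => dotp (P i) u) m.
exists p => //; apply: ge_sup; first by case: K0 => x Kx; exists (dotp x u); exists x.
have u1' : enorm u = 1 by rewrite /enorm u1 sqrtr1.
move=> _ [x /KS [k [z [l [Sz [l0 [l1 ->]]]]]] <-].
have -> : dotp (\sum_(i < k) l i *: z i) u = \sum_(i < k) l i * dotp (z i) u.
  elim/big_rec2: _ => [|i a b _ <-]; last by rewrite dotpDl dotpZl.
  by rewrite /dotp big1// => i _; rewrite mxE mul0r.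
rewrite -[leRHS]mul1r -l1 mulr_suml; apply: ler_sum => i _; rewrite ler_wpM2l//.
have [j jm Pj] := PS _ (Sz i).
have : dotp (z i - P j) u <= e.
  by rewrite (le_trans (cauchy_schwarz _ _))// u1' mulr1.
by rewrite dotpBl; have := Pp _ jm; lra.
Qed.

(** [support_net] in the directions [v] and [- v] of the normalized [u] gives two vertices at least
    [Theta - 2 e] apart along [v]. Scaling by [|u|] puts the bound in a form that can be averaged
    over Gaussian vectors. *)
Lemma variation_dotp_ge n (K S : set 'rV[R]_n) Theta P m e (u : 'rV[R]_n) :
  K !=set0 -> constant_width K Theta -> K `<=` co S -> net S P m e ->
  2 * (Theta - 2 * e) * enorm u - `|dotp (P 0%N - P m) u| <=
  \sum_(k < m) `|dotp (P k - P k.+1) u|.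
Proof.
move=> K0 KT KS PS.
have [u0|u0] := eqVneq (enorm u) 0.
  rewrite u0 mulr0 sub0r; apply: (@le_trans _ _ 0); first by rewrite oppr_le0.
  by apply: sumr_ge0.
have {}u0 : 0 < enorm u by rewrite lt_neqAle eq_sym u0 enorm_ge0.
pose v := (enorm u)^-1 *: u.
have uE : u = enorm u *: v by rewrite scalerA divff ?scale1r// gt_eqF.
have v1 : dotp v v = 1.
  rewrite /v dotpZl dotpZr -sqr_enorm; field; by rewrite gt_eqF.
have v1' : dotp (- v) (- v) = 1 by rewrite dotpNl dotpNr opprK.
have [p pm hp] := support_net K0 KS PS v1.
have [q qm hq] := support_net K0 KS PS v1'.
rewrite dotpNr in hq.
have /esym TE := KT v v1; rewrite /width_fun in TE.
have := variation_ge (fun k => dotp (P k) v) pm qm => /= h.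
have {}h : 2 * (Theta - 2 * e) - `|dotp (P 0%N - P m) v| <=
    \sum_(k < m) `|dotp (P k - P k.+1) v|.
  under eq_bigr do rewrite dotpBl; rewrite dotpBl; lra.
have e1 (w : 'rV[R]_n) : `|dotp w u| = enorm u * `|dotp w v|.
  by rewrite {1}uE dotpZr normrM gtr0_norm.
rewrite e1; under eq_bigr do rewrite e1.
by rewrite -mulr_sumr mulrC -mulrBr ler_pM2l.
Qed.

(* [A] embeds ['rV_k] isometrically, [B] is its adjoint, i.e. the projection. *)
Lemma projected_length_ge k n (K S : set 'rV[R]_n) Theta P m e
    (A : 'rV[R]_k -> 'rV[R]_n) (B : 'rV[R]_n -> 'rV[R]_k) :
  (forall v g, dotp v (A g) = dotp (B v) g) ->
  (forall g, enorm (A g) = enorm g) ->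
  K !=set0 -> constant_width K Theta -> K `<=` co S -> net S P m e ->
  2 * (Theta - 2 * e) * (Num.sqrt pi * rho R k) - enorm (B (P 0%N - P m)) <=
  \sum_(i < m) enorm (B (P i - P i.+1)).
Proof.
move=> AB A1 K0 KT KS PS.
have lB v : lipn (fun g : 'rV[R]_k => `|dotp (B v) g|).
  exact: (lipn_dotp (B v) (lip_normr R)).
(* The variation bound in the direction [A g], averaged over [g]. *)
have h : gmeann (fun g : 'rV[R]_k => 2 * (Theta - 2 * e) * enorm g +
      -1 * `|dotp (B (P 0%N - P m)) g|) <=
    gmeann (fun g : 'rV[R]_k => \sum_(i < m) `|dotp (B (P i - P i.+1)) g|).
  apply: gmeann_le.
  - by apply: lipnD; apply: lipnZ; [exact: lipn_norm|exact: lB].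
  - by apply: lipn_sum => i; exact: lB.
  move=> g; rewrite mulN1r -AB -A1; under eq_bigr do rewrite -AB.
  exact: variation_dotp_ge K0 KT KS PS.
rewrite gmeannD ?gmeannZ in h; last 4 first.
- exact: lB.
- exact: lipn_norm.
- by apply: lipnZ; exact: lipn_norm.
- by apply: lipnZ; exact: lB.
rewrite gmeann_sum in h; last by move=> i; exact: lB.
rewrite gmeann_normr_dotp (eq_bigr _ (fun i _ => gmeann_normr_dotp _)) in h.
rewrite -mulr_suml ler_pdivlMr ?sqrt_pi_gt0// in h.
rewrite -/(rho R k) mulrDl mulN1r mulNr divfK ?gt_eqF ?sqrt_pi_gt0// in h.
by rewrite mulrCA mulrC.
Qed.

(* For [w = 0] the quotient is [0], so that [householder 0] is the identity. *)
Definition householder n (w x : 'rV[R]_n) : 'rV[R]_n :=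
  x - (2 * dotp x w / dotp w w) *: w.

Lemma householderC n (w x y : 'rV[R]_n) :
  dotp x (householder w y) = dotp (householder w x) y.
Proof.
rewrite /householder dotpBl dotpBr dotpZl dotpZr (dotpC w y); congr (_ - _); ring.
Qed.

Lemma householderK n (w : 'rV[R]_n) : involutive (householder w).
Proof.
move=> x; have [w0|w0] := eqVneq (dotp w w) 0.
  by rewrite /householder w0 invr0 !mulr0 !scale0r !subr0.
rewrite /householder dotpBl dotpZl divfK//.
rewrite -addrA -opprD -scalerDl -mulrDl.
have -> : 2 * dotp x w + 2 * (dotp x w - 2 * dotp x w) = 0 by ring.
by rewrite mul0r scale0r subr0.
Qed.

Lemma householder_swap n (x y : 'rV[R]_n) : dotp x x = dotp y y ->
  householder (y - x) x = y.
Proof.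
move=> xy; have [w0|w0] := eqVneq (dotp (y - x) (y - x)) 0.
  have w0' : y - x = 0 by apply: enorm_eq0; rewrite /enorm w0 sqrtr0.
  by rewrite /householder w0' scaler0 subr0; apply/esym/eqP; rewrite -subr_eq0 w0'.
rewrite /householder.
have -> : 2 * dotp x (y - x) = - dotp (y - x) (y - x).
  by rewrite !dotpBl !dotpBr xy (dotpC y x); ring.
by rewrite mulNr divff// scaleN1r opprK addrC subrK.
Qed.

(** A Householder reflection exchanges [e] with the first basis vector, hence carries the hyperplane
    orthogonal to [e] onto the last [k] coordinates. *)
Lemma orthogonal_projection k (e : 'rV[R]_k.+1) : dotp e e = 1 ->
  exists (A : 'rV[R]_k -> 'rV[R]_k.+1) (B : 'rV[R]_k.+1 -> 'rV[R]_k),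
  [/\ forall v g, dotp v (A g) = dotp (B v) g,
      forall g, enorm (A g) = enorm g &
      forall v, dotp v v = dotp (B v) (B v) + dotp v e ^+ 2].
Proof.
move=> e1; pose e0 : 'rV[R]_k.+1 := vcons 1 0.
have dot0 x : dotp x e0 = x ord0 ord0.
  rewrite dotp_vcons mulr1 [X in _ + X]big1 ?addr0// => i _.
  by rewrite !mxE mulr0.
have e01 : dotp e0 e0 = 1 by rewrite dot0 vcons0.
pose h := householder (e - e0).
have he0 : h e0 = e by apply: householder_swap; rewrite e01.
have hC := householderC (e - e0); have hK := householderK (e - e0).
have h_iso x : dotp (h x) (h x) = dotp x x by rewrite hC hK.
exists (fun g => h (vcons 0 g)), (fun v => vtail (h v)); split.
- by move=> v g; rewrite hC dotp_vcons mulr0 add0r.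
- by move=> g; rewrite /enorm h_iso dotp_vcons2 expr0n add0r.
- move=> v; have ve : dotp v (h e0) = h v ord0 ord0 by rewrite hC dot0.
  by rewrite he0 in ve; rewrite ve -(h_iso v) [LHS]dotp_vtail addrC.
Qed.

(** The triangle inequality for the plane vectors [(a i, b i)], proved by testing each of them
    against [(D, L)]. *)
Lemma sqrt_sum_sqr_le (I : Type) (r : seq I) (a b : I -> R) (D L : R) :
  (forall i, 0 <= a i) -> (forall i, 0 <= b i) -> 0 <= D -> 0 <= L ->
  D <= \sum_(i <- r) a i -> L <= \sum_(i <- r) b i ->
  Num.sqrt (D ^+ 2 + L ^+ 2) <= \sum_(i <- r) Num.sqrt (a i ^+ 2 + b i ^+ 2).
Proof.
move=> a0 b0 D0 L0 Da Lb; set M := Num.sqrt _.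
have M2 : M ^+ 2 = D ^+ 2 + L ^+ 2 by rewrite sqr_sqrtr// addr_ge0 ?sqr_ge0.
have : 0 <= M by exact: sqrtr_ge0.
rewrite le_eqVlt => /predU1P[<-|M0]; first by apply: sumr_ge0 => i _; exact: sqrtr_ge0.
rewrite -(ler_pM2l M0) -expr2 M2 mulr_sumr.
apply: (@le_trans _ _ (\sum_(i <- r) (D * a i + L * b i))).
  by rewrite big_split -!mulr_sumr !expr2 lerD// ler_wpM2l.
apply: ler_sum => i _; rewrite -sqrtrM ?addr_ge0 ?sqr_ge0//.
rewrite -[leLHS]ger0_norm ?addr_ge0 ?mulr_ge0// -sqrtr_sqr ler_wsqrtr//.
rewrite -subr_ge0.
have -> : (D ^+ 2 + L ^+ 2) * (a i ^+ 2 + b i ^+ 2) - (D * a i + L * b i) ^+ 2 =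
  (D * b i - L * a i) ^+ 2 by ring.
exact: sqr_ge0.
Qed.
End Geometry.

(** * Curves *)

Section Curve.
Variable R : realType.

(** By compactness: near each point of the segment, all small enough [d] work. *)
Lemma uniform_continuity n (phi : R -> 'rV[R]_n) (a b e : R) :
  {within `[a, b], continuous phi} -> 0 < e ->
  exists2 d, 0 < d & forall x y, a <= x <= b -> a <= y <= b -> `|x - y| < d ->
    forall i, `|phi x ord0 i - phi y ord0 i| < e.
Proof.
move=> /subspace_continuousP cphi e0.
pose Q (d : R) (x : R) := forall y, a <= y <= b -> `|x - y| < d ->
    forall i, `|phi x ord0 i - phi y ord0 i| < e.
have e2 : 0 < e / 2 by rewrite divr_gt0.
have /compact_near_coveringP/near_covering_withinP cov := @segment_compact R a b.
have : \forall d \near 0^'+, `[a, b]%classic `<=` Q d.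
  apply: cov => x xab.
  have /cvg_ballP/(_ _ e2) := cphi x xab.
  rewrite near_withinE => /nbhs_ballP[d d0 hd].
  have {}hd y : a <= y <= b -> `|x - y| < d ->
      forall i, `|phi x ord0 i - phi y ord0 i| < e / 2.
    move=> yab xy i; have := hd y; rewrite -ball_normE /= in_itv/=.
    by move=> /(_ xy yab)[_ /(_ ord0 i)]; rewrite -ball_normE.
  (* Radii are halved so that a point within [d / 2] of [x'] is still within [d] of [x]. *)
  exists (ball x (d / 2), [set r | r < d / 2]).
    split; first by apply: nbhsx_ballx; rewrite divr_gt0.
    by apply: nbhs_right_lt; rewrite divr_gt0.
  move=> [x' r] [/= xx' rd]; rewrite in_itv/= => x'ab y yab x'y i.
  rewrite -ball_normE /= in xx'.
  have h1 := hd x' x'ab; have h2 := hd y yab.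
  have d2 : d / 2 < d by rewrite ltr_pdivrMr// ltr_pMr// ltr1n.
  have := h1 (lt_trans xx' d2) i.
  have xy : `|x - y| < d.
    by have := ler_distD (x' : R) x y; lra.
  have := h2 xy i.
  have := ler_distD (phi x ord0 i) (phi x' ord0 i) (phi y ord0 i).
  rewrite (distrC (phi x' ord0 i) (phi x ord0 i)); lra.
rewrite near_withinE => /nbhs_ballP[d d0 hd]; exists (d / 2); first by rewrite divr_gt0.
move=> x y xab yab xy; apply: (hd (d / 2)) => //.
- rewrite -ball_normE /= sub0r normrN gtr0_norm ?divr_gt0//.
  by rewrite ltr_pdivrMr// ltr_pMr// ltr1n.
- by rewrite /= divr_gt0.
Qed.

Lemma curve_net n (phi : R -> 'rV[R]_n) (a b e : R) : a <= b ->
  {within `[a, b], continuous phi} -> 0 < e ->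
  exists m (t : nat -> R), Defs.partition a b m t /\
    net (phi @` `[a, b]) (fun i => phi (t i)) m e.
Proof.
rewrite le_eqVlt => /predU1P[<- _ e0|ab cphi e0].
  exists 0%N, (fun=> a); split; first by [].
  move=> _ [x /= /[!in_itv]/= xa <-]; exists 0%N => //.
  have -> : x = a by apply/eqP; rewrite eq_le andbC.
  by rewrite subrr -(scale0r (phi a)) enormZ normr0 mul0r ltW.
(* With tolerance [e / (n + 1)] in each coordinate, the [n] coordinates add up to at most [e]; the
   denominator is positive for every [n]. *)
have n1 : 0 < n%:R + 1 :> R by rewrite ltr_wpDl.
have [d d0 hd] := uniform_continuity cphi (divr_gt0 e0 n1).
have ba : 0 < b - a by rewrite subr_gt0.
(* The successor makes [m] positive and the mesh [s] strictly smaller than [d]. *)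
pose m := (Num.truncn ((b - a) / d)).+1.
have m0 : 0 < m%:R :> R by rewrite ltr0n.
pose s := (b - a) / m%:R.
have s0 : 0 < s by rewrite divr_gt0.
have sd : s < d.
  rewrite ltr_pdivrMr// mulrC -ltr_pdivrMr//; apply: truncnS_gt.
have ms : m%:R * s = b - a by rewrite mulrC divfK// gt_eqF.
exists m, (fun i => a + i%:R * s); split.
  split; first by rewrite mul0r addr0.
  split; first by rewrite ms addrC subrK.
  by move=> i _; rewrite ltrD2l ltr_pM2r// ltr_nat.
move=> _ [x /= /[!in_itv]/= xab <-].
have [ax xb] := andP xab.
have xs0 : 0 <= (x - a) / s by rewrite divr_ge0 ?subr_ge0// ltW.
pose i := Num.truncn ((x - a) / s).
have /andP[i1 i2] := truncn_itv xs0.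
rewrite -/i ler_pdivlMr// in i1; rewrite -/i ltr_pdivrMr// -natr1 mulrDl mul1r in i2.
have im : (i <= m)%N.
  rewrite -(ler_nat R) -(ler_pM2r s0) ms; lra.
exists i => //.
have tab : a <= a + i%:R * s <= b.
  apply/andP; split; last lra.
  by rewrite lerDl mulr_ge0// ltW.
have xt : `|x - (a + i%:R * s)| < d.
  rewrite ger0_norm; lra.
have h := hd _ _ xab tab xt.
apply: (le_trans (enorm_le_norm1 _)).
apply: (@le_trans _ _ (\sum_(j < n) e / (n%:R + 1))).
  by apply: ler_sum => j _; rewrite !mxE ltW.
rewrite sumr_const card_ord -[leLHS]mulr_natl mulrCA -[leRHS]mulr1.
by rewrite ler_wpM2l ?(ltW e0)// ler_pdivrMr// mul1r lerDl.
Qed.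

(** * From nearly inscribed polygons to the curve *)

(** The error term is the exact cost of [Theta - 2 e] in the estimate without projection, and bounds
    the cost in the other case. *)
Lemma polygon_length_ge k (K S : set 'rV[R]_k.+2) Theta P m e :
  K !=set0 -> constant_width K Theta -> K `<=` co S -> net S P m e -> 0 <= e ->
  2 * (pi - 1) / Num.sqrt pi * rho R k.+2 * Theta - 4 * e * Num.sqrt pi * rho R k.+2 <=
  \sum_(i < m) enorm (P i - P i.+1).
Proof.
move=> K0 KT KS PS e0.
set sp := Num.sqrt pi; set r := rho R k.+2; set r' := rho R k.+1.
have sp0 : 0 < sp by exact: sqrt_pi_gt0.
have sp2 : pi = sp ^+ 2 :> R by rewrite sqr_sqrtr// pi_ge0.
have pi2 := pi_ge2 R.
have r0 : 0 <= r by exact: rho_ge0.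
set v := P 0%N - P m; set d := enorm v.
(* At this threshold the estimate without projection gives precisely the claimed bound. *)
have [dle|dgt] := leP d (2 * r / sp * Theta).
  have := projected_length_ge (A := id) (B := id) (fun _ _ => erefl) (fun=> erefl) K0 KT KS PS.
  rewrite -/sp -/r -/v -/d; apply: le_trans.
  have -> : 2 * (pi - 1) / sp * r * Theta = 2 * Theta * sp * r - 2 * r / sp * Theta.
    by rewrite sp2; field; rewrite gt_eqF.
  lra.
pose T := Theta - 2 * e; pose q := 2 * (pi - 1) / sp * r.
have pi1 : 0 <= pi - 1 :> R by lra.
have q0 : 0 <= q by rewrite /q mulr_ge0// divr_ge0 ?(ltW sp0)// mulr_ge0.
apply: (@le_trans _ _ (q * T)).
  have : q <= 2 * sp * r.
    rewrite /q ler_wpM2r// ler_pdivrMr// -mulrA -expr2 -sp2; lra.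
  by move=> /(ler_wpM2l e0); rewrite /q /T; lra.
have [T0|T0] := leP T 0.
  apply: (@le_trans _ _ 0); first by rewrite mulr_ge0_le0.
  by apply: sumr_ge0 => i _; exact: enorm_ge0.
have T_le : T <= Theta by rewrite /T; lra.
have rsp0 : 0 <= 2 * r / sp by apply: divr_ge0; [exact: mulr_ge0|exact: ltW].
have rT : 2 * r / sp * T <= d.
  by apply: le_trans (ltW dgt); rewrite ler_wpM2l.
have rT0 : 0 <= 2 * r / sp * T.
  by rewrite mulr_ge0 ?(ltW T0).
have d0 : 0 < d.
  by apply: le_lt_trans dgt; rewrite mulr_ge0 ?(le_trans (ltW T0) T_le).
pose u := d^-1 *: v.
have vu : dotp v u = d.
  by rewrite dotpZr -sqr_enorm -/d expr2 mulrA mulVf ?mul1r// gt_eqF.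
have u1 : dotp u u = 1 by rewrite {1}/u dotpZl vu mulVf// gt_eqF.
have [A [B [AB A1 pyth]]] := orthogonal_projection u1.
(* As [v] is parallel to [u], its projection vanishes, so the projected polygon is closed. *)
have Bv : enorm (B v) = 0.
  have := pyth v; rewrite vu -sqr_enorm -/d => h.
  have Bv0 : dotp (B v) (B v) = 0 by lra.
  by rewrite /enorm Bv0 sqrtr0.
have := projected_length_ge AB A1 K0 KT KS PS.
rewrite -/v Bv subr0 -/T -/sp -/r' => hL.
set L := (X in X <= _) in hL.
have r'0 : 0 <= r' by exact: rho_ge0.
have L0 : 0 <= L by apply: mulr_ge0; apply: mulr_ge0 => //; exact: ltW.
have hD : d <= \sum_(i < m) `|dotp (P i - P i.+1) u|.
  have := dist_le_variation (fun i => dotp (P i) u) (leq0n m).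
  rewrite -dotpBl -/v vu gtr0_norm// big_mkord => /le_trans; apply.
  by apply: ler_sum => i _; rewrite -dotpBl.
have -> : \sum_(i < m) enorm (P i - P i.+1) = \sum_(i < m) Num.sqrt
    (`|dotp (P i - P i.+1) u| ^+ 2 + enorm (B (P i - P i.+1)) ^+ 2).
  apply: eq_bigr => i _; rewrite {1}/enorm pyth real_normK ?num_real//.
  by rewrite sqr_enorm addrC.
apply: le_trans (sqrt_sum_sqr_le _ _ (ltW d0) L0 hD hL); last 2 first.
- by move=> i; exact: normr_ge0.
- by move=> i; exact: enorm_ge0.
have qT0 : 0 <= q * T by apply: mulr_ge0 => //; exact: ltW.
rewrite -[leLHS](ger0_norm qT0) -sqrtr_sqr ler_wsqrtr//.
have dd : (2 * r / sp * T) ^+ 2 <= d ^+ 2 by rewrite ler_sqr ?nnegrE// ltW.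
have ratio := rho_ratio R k; rewrite -/r -/r' in ratio.
(* [rho_ratio] multiplied by [pi] reads [(pi - 2) r ^ 2 <= pi r' ^ 2]. *)
have LL : (2 * T) ^+ 2 * (pi - 2) * r ^+ 2 <= L ^+ 2.
  have -> : L ^+ 2 = (2 * T) ^+ 2 * pi * r' ^+ 2 by rewrite /L sp2; ring.
  have -> : pi - 2 = pi * (1 - 2 / pi) :> R by rewrite mulrBr mulr1 mulrCA divff ?mulr1// gt_eqF ?pi_gt0.
  rewrite -mulrA -[leRHS]mulrA ler_wpM2l ?sqr_ge0// -mulrA.
  exact: ler_wpM2l (pi_ge0 R) _ _ ratio.
apply: (le_trans _ (lerD dd LL)).
(* This amounts to [(pi - 1) ^ 2 = 1 + pi (pi - 2)]. *)
have -> : (q * T) ^+ 2 = (2 * r / sp * T) ^+ 2 + (2 * T) ^+ 2 * (pi - 2) * r ^+ 2.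
  by rewrite /q sp2; field; rewrite gt_eqF.
by [].
Qed.

End Curve.

Theorem theorem3 (R : realType) (n : nat) (K : set 'rV[R]_n) (Theta : R)
    (a b : R) (phi : R -> 'rV[R]_n) :
  (2 <= n)%N ->
  convex_body K -> constant_width K Theta ->
  a <= b -> {within `[a, b], continuous phi} ->
  K `<=` co (phi @` `[a, b]) ->
  ((2 * (pi - 1) * Gamma ((n%:R + 1) / 2)
     / (Num.sqrt pi * Gamma (n%:R / 2)) * Theta)%:E
   <= curve_length phi a b)%E.
Proof.
case: n K phi => [//|[//|k]] K phi n2 [K0 _] KT ab cphi Kphi.
have -> : 2 * (pi - 1) * Gamma ((k.+2%:R + 1) / 2) / (Num.sqrt pi * Gamma (k.+2%:R / 2)) =
    2 * (pi - 1) / Num.sqrt pi * rho R k.+2.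
  by rewrite rhoE// invfM; ring.
apply/lee_addgt0Pr => e e0.
(* The coefficient of the error term; the tolerance [e / (C + 1)] keeps the error within [e] and
   avoids dividing by zero. *)
pose C : R := 4 * Num.sqrt pi * rho R k.+2.
have C0 : 0 <= C by rewrite /C mulr_ge0 ?rho_ge0// mulr_ge0 ?sqrtr_ge0.
have C1 : 0 < C + 1 by lra.
have e'0 : 0 < e / (C + 1) by exact: divr_gt0.
have [m [t [tab tnet]]] := curve_net ab cphi e'0.
have := polygon_length_ge K0 KT Kphi tnet (ltW e'0).
set l := \sum_(i < m) _ => hl.
have : (l%:E <= curve_length phi a b)%E.
  by apply: ereal_sup_ubound; exists m, t.
move=> /(leeD2r e%:E); apply: le_trans; rewrite -EFinD lee_fin.
have : C * (e / (C + 1)) <= e.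
  by rewrite mulrCA -[leRHS]mulr1 ler_wpM2l ?(ltW e0)// ler_pdivrMr// mul1r lerDl.
move: hl; rewrite /C; lra.
Qed.
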